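(* Let $n,m$ be positive integers with $n+1\le m\le 2n$, let $\Omega\subseteq\mathbb{R}^m$ be an open set and let $f=(f^1,\dots,f^{2n+1})\in W^{1,1}_{\mathrm{loc}}(\Omega,\mathbb{R}^{2n+1})$ satisfy $$df^{2n+1}=\sum_{j=1}^n\big(f^j\,df^{j+n}-f^{j+n}\,df^j\big)\quad\text{almost everywhere in }\Omega.$$ Then the Jacobian matrix $Df$ has rank at most $n$ almost everywhere in $\Omega$.
   Context: Differentials are weak (Sobolev) differentials, defined almost everywhere. *)

(* Defs.v *)
From HB Require Import structures.
From mathcomp Require Import all_boot all_order all_algebra.
From mathcomp Require Import all_classical all_reals all_analysis.
Set Implicit Arguments. Unset Strict Implicit. Unset Printing Implicit Defensive.
Import Order.TTheory GRing.Theory Num.Theory.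
Import numFieldNormedType.Exports.
Local Open Scope classical_set_scope.
Local Open Scope ring_scope.

Definition rv_ext (R : realType) (m : nat) (v : 'rV[R]_m) (t : R) : 'rV[R]_m.+1 :=
  \row_(i < m.+1) match (insub (nat_of_ord i) : option 'I_m) with
                  | Some j => v ord0 j
                  | None => t end.

(* Lebesgue integral over R^m, written as the iterated one-dimensional
   Lebesgue integral (Fubini/Tonelli). *)
Fixpoint iint (R : realType) (m : nat) : ('rV[R]_m -> \bar R) -> \bar R :=
  match m with
  | O => fun g => g 0
  | S k => fun g =>
      (\int[@lebesgue_measure R]_(t in [set: R]) iint (fun v => g (rv_ext v t)))%E
  end.

Definition lnull (R : realType) (m : nat) (N : set 'rV[R]_m) : Prop :=
  forall eps : R, 0 < eps ->
  exists a b : nat -> 'rV[R]_m,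
    (forall k i, a k ord0 i <= b k ord0 i) /\
    N `<=` \bigcup_k [set x | forall i, a k ord0 i <= x ord0 i <= b k ord0 i] /\
    (\sum_(0 <= k <oo) (\prod_(i < m) (b k ord0 i - a k ord0 i))%:E < eps%:E)%E.

Definition ae_on (R : realType) (m : nat) (Omega : set 'rV[R]_m)
  (P : 'rV[R]_m -> Prop) : Prop :=
  exists N, lnull N /\ forall x, Omega x -> ~ N x -> P x.

Definition borel_on (R : realType) (m : nat) (Omega : set 'rV[R]_m)
  (g : 'rV[R]_m -> R) : Prop :=
  forall U : set R, open U -> <<s (@open 'rV[R]_m) >> (Omega `&` g @^-1` U).

Definition loc_int (R : realType) (m : nat) (Omega : set 'rV[R]_m)
  (g : 'rV[R]_m -> R) : Prop :=
  borel_on Omega g /\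
  forall K : set 'rV[R]_m, compact K -> K `<=` Omega ->
    (iint (fun x => (\1_K x * `|g x|)%:E) < +oo)%E.

Definition ebasis (R : realType) (m : nat) (i : 'I_m) : 'rV[R]_m := delta_mx ord0 i.
Definition pderiv (R : realType) (m : nat) (i : 'I_m) (phi : 'rV[R]_m -> R)
  : 'rV[R]_m -> R := fun x => 'D_(@ebasis R m i) phi x.
Definition pderivs (R : realType) (m : nat) (s : seq 'I_m) (phi : 'rV[R]_m -> R)
  : 'rV[R]_m -> R := foldr (@pderiv R m) phi s.

Definition smooth (R : realType) (m : nat) (phi : 'rV[R]_m -> R) : Prop :=
  forall s : seq 'I_m,
    continuous (pderivs s phi) /\
    forall (i : 'I_m) (x : 'rV[R]_m), derivable (pderivs s phi) x (@ebasis R m i).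

Definition test_fun (R : realType) (m : nat) (Omega : set 'rV[R]_m)
  (phi : 'rV[R]_m -> R) : Prop :=
  smooth phi /\
  exists K : set 'rV[R]_m, [/\ compact K, K `<=` Omega &
                             forall x, ~ K x -> phi x = 0].

(* f : Omega -> R^k belongs to W^{1,1}_loc(Omega, R^k) and Df is (a
   representative of) its weak Jacobian matrix: (Df x) j i = d_i f^j (x).
   Both are only determined almost everywhere, so we ask for Borel
   representatives f0, Df0 agreeing a.e. with f, Df. *)
Definition weak_jacobian (R : realType) (m k : nat) (Omega : set 'rV[R]_m)
  (f : 'rV[R]_m -> 'rV[R]_k) (Df : 'rV[R]_m -> 'M[R]_(k, m)) : Prop :=
  exists (f0 : 'rV[R]_m -> 'rV[R]_k) (Df0 : 'rV[R]_m -> 'M[R]_(k, m)),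
  [/\ ae_on Omega (fun x => f x = f0 x),
      ae_on Omega (fun x => Df x = Df0 x),
      forall j, loc_int Omega (fun x => f0 x ord0 j),
      forall j i, loc_int Omega (fun x => Df0 x j i) &
      forall phi, test_fun Omega phi -> forall j i,
        iint (fun x => (f0 x ord0 j * pderiv i phi x)%:E) =
        (- iint (fun x => (Df0 x j i * phi x)%:E))%E].

(* Main.v *)
Require Import Defs.
From HB Require Import structures.
From mathcomp Require Import all_boot all_order all_algebra.
From mathcomp Require Import all_classical all_reals all_analysis.
From mathcomp Require Import measurable_realfun ring lra zify.
Import Order.TTheory GRing.Theory Num.Theory.
Import numFieldNormedType.Exports.
Set Implicit Arguments. Unset Strict Implicit. Unset Printing Implicit Defensive.
Local Open Scope classical_set_scope.
Local Open Scope ring_scope.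

(** A horizontal map has zero symplectic area on every closed curve.  For a fixed
    side length [h] and almost every [x], the map is absolutely continuous along the
    four sides of the square with corners [x], [x + h e_i], [x + h e_i + h e_j],
    [x + h e_j], so the contact equation can be integrated around it: the increments
    of the last coordinate cancel, and what remains is a shoelace sum.  That sum is
    [2 h^2 omega(d_i f, d_j f)(x)] up to [h^2] times the mean deviation of [Df] on the
    four sides from [Df(x)].  By continuity of translations in [L^1] this mean deviation
    tends to [0] in [L^1] as [h] tends to [0], hence its infimum over [h] vanishes almost
    everywhere, and the columns of [Df(x)] span an isotropic subspace, whose dimension is
    at most [n].  The last row of [Df] is a combination of the other ones.

    The iterated integral [iint] is the integral of the measure [mu m], and the [lnull]
    sets are its negligible sets because the outer measure defined by countable box
    covers is a measure on Borel sets (hyperplanes split boxes into boxes) which agrees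
    with [mu m] on boxes. *)

(** * Lebesgue measure on R^m *)

(** The obstacle is regularity. For smooth [f], the exterior derivative of the contact equation
    gives the vanishing of the sum of [df^j /\ df^{j+n}] at once. With [Df] only in [L^1] this
    two-form need not be integrable, so it has no evident meaning as a distribution, and mollifying
    [f] destroys the contact equation. Integration over closed squares uses only one-dimensional
    first-order calculus. The area is of order [h^2], so each side must be controlled to precision
    [o(h^2)], although the derivatives are controlled only up to [o(1)] in the mean. This works
    because [U 0 * V h - V 0 * U h] is the exact integral of the contact form when [U] and [V] are
    affine: the products of the linear parts of the increments cancel by antisymmetry, and every
    remaining term is of order [h^2 d], where [d] bounds the mean deviation. At a given point, one
    good side length for each tolerance is enough. Smallness in [L^1] provides it through an
    infimum, without Lebesgue points and without extracting a subsequence. *)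

HB.instance Definition _ (R : realType) (m : nat) :=
  Measurable.copy 'rV[R]_m (g_sigma_algebraType (@open 'rV[R]_m)).

Section borel_rV.
Context {R : realType}.

Definition box (m : nat) (a b : 'rV[R]_m) : set 'rV[R]_m :=
  [set x | forall i, a ord0 i <= x ord0 i <= b ord0 i].

Lemma measurable_rVE m : @measurable _ 'rV[R]_m = <<s @open 'rV[R]_m >>.
Proof. by []. Qed.

Lemma open_measurable_rV m (U : set 'rV[R]_m) : open U -> measurable U.
Proof. by move=> oU; exact: sub_sigma_algebra. Qed.

Lemma continuous_measurable_rV m (f : 'rV[R]_m -> R) :
  continuous f -> measurable_fun setT f.
Proof.
move=> /continuousP cf; apply: (measurability _ (measurable_realfun.RGenOpens.measurableE R)).
move=> _ [_ [a [b ->] <-]]; rewrite setTI; apply: open_measurable_rV.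
exact/cf/interval_open.
Qed.

Lemma measurable_coord m (i : 'I_m) :
  measurable_fun setT (fun x : 'rV[R]_m => x ord0 i).
Proof. by apply: continuous_measurable_rV => x; exact: coord_continuous. Qed.

(** Balls of the sup norm are boxes. The empty set stands for the boxes that leave [U], so that the
    union runs over a countable type. *)
Lemma open_bigcup_rat_box m (U : set 'rV[R]_m) : open U ->
  U = \bigcup_(p : 'rV[rat]_m * 'rV[rat]_m) 
    (if `[< box (map_mx ratr p.1) (map_mx ratr p.2) `<=` U >]
     then box (map_mx ratr p.1) (map_mx ratr p.2) else set0).
Proof.
move=> oU; apply/seteqP; split => [x Ux|x [p _]]; last first.
  by case: asboolP => // + px; apply.
have /nbhs_ballP[e /= e0 xeU] := open_nbhs_nbhs (conj oU Ux).
have H1 (i : 'I_m) : exists q : rat, x ord0 i - e < ratr q < x ord0 i.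
  have [|q] := @rat_in_itvoo R (x ord0 i - e) (x ord0 i); first by lra.
  by rewrite in_itv /=; exists q.
have H2 (i : 'I_m) : exists q : rat, x ord0 i < ratr q < x ord0 i + e.
  have [|q] := @rat_in_itvoo R (x ord0 i) (x ord0 i + e); first by lra.
  by rewrite in_itv /=; exists q.
have [q1 q1P] := choice H1; have [q2 q2P] := choice H2.
exists (\row_i q1 i, \row_i q2 i) => //=.
case: asboolP => [_ i|]; first by rewrite !mxE; have := q1P i; have := q2P i; lra.
case=> y yb; apply: xeU; split => // i j; rewrite !ord1.
have := yb j; rewrite !mxE /ball /= ltr_norml; have := q1P j; have := q2P j; lra.
Qed.

Lemma box_bigcap m (a b : 'rV[R]_m) :
  box a b = \bigcap_(i in [set: 'I_m]) ((fun x : 'rV[R]_m => x ord0 i) @^-1` `[a ord0 i, b ord0 i]).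
Proof.
apply/seteqP; split => x xab i /=; first by move=> _; rewrite in_itv /= xab.
by have := xab i I; rewrite /= in_itv.
Qed.

Lemma measurable_fun_rV d (X : measurableType d) m (f : X -> 'rV[R]_m) :
  (forall i, measurable_fun setT (fun x => f x ord0 i)) -> measurable_fun setT f.
Proof.
move=> mf; apply: (measurability _ (measurable_rVE m)).
move=> _ [U oU <-]; rewrite setTI (open_bigcup_rat_box oU) preimage_bigcup.
apply: countable_bigcupT_measurable => // -[p q] /=.
case: ifP => _; last by rewrite preimage_set0.
rewrite box_bigcap preimage_bigcap; apply: fin_bigcap_measurable => // i _.
by rewrite -comp_preimage -[X in measurable X]setTI; exact: mf.
Qed.

Lemma measurable_box m (a b : 'rV[R]_m) : measurable (box a b).
Proof.
rewrite box_bigcap; apply: fin_bigcap_measurable => // i _.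
by rewrite -[X in measurable X]setTI; exact: measurable_coord.
Qed.

Lemma measurable_rV_box m :
  @measurable _ 'rV[R]_m = <<s [set A | exists a b, A = box a b] >>.
Proof.
apply/seteqP; split => A.
  apply: smallest_sub; first exact: smallest_sigma_algebra.
  move=> U oU; rewrite (open_bigcup_rat_box oU).
  pose G := [set A : set 'rV[R]_m | exists a b, A = box a b].
  apply: (@countable_bigcupT_measurable _ (g_sigma_algebraType G)) => // -[p q] /=.
  case: ifP => _; last exact: measurable0.
  by apply: sub_sigma_algebra; exists (map_mx ratr p), (map_mx ratr q).
apply: smallest_sub; first exact: smallest_sigma_algebra.
by move=> _ [a [b ->]]; exact: measurable_box.
Qed.

Lemma boxI m (a b c d : 'rV[R]_m) : box a b `&` box c d =
  box (\row_i Num.max (a ord0 i) (c ord0 i)) (\row_i Num.min (b ord0 i) (d ord0 i)).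
Proof.
apply/seteqP; split => x.
  by move=> [xab xcd] i; rewrite !mxE ge_max le_min; have := xab i; have := xcd i; lra.
by move=> xP; split => i; have := xP i; rewrite !mxE ge_max le_min; lra.
Qed.

Lemma bigcup_box_const m :
  \bigcup_k box (const_mx (- k%:R)) (const_mx k%:R) = [set: 'rV[R]_m].
Proof.
apply/seteqP; split => // x _; exists (Num.trunc `|x|).+1 => // i; rewrite !mxE -ler_norml.
apply: le_trans (ltW (truncnS_gt _)).
by rewrite [leRHS]mx_normrE; exact: (le_bigmax _ (fun ij => `|x ij.1 ij.2|) (ord0, i)).
Qed.

Lemma measurable_rv_ext m :
  measurable_fun setT (fun p : R * 'rV[R]_m => rv_ext p.2 p.1).
Proof.
apply: measurable_fun_rV => i; rewrite /rv_ext.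
under eq_fun do rewrite mxE.
case: insubP => [j _ _|_]; last exact: measurable_fst.
exact: (measurableT_comp (measurable_coord j) measurable_snd).
Qed.

End borel_rV.

Section image_measure.
Local Open Scope ereal_scope.
Context d d' (X : measurableType d) (Y : measurableType d') (R : realType).
Variables (nu : {measure set X -> \bar R}) (f : X -> Y).
Hypothesis mf : measurable_fun setT f.

(* [pushforward nu f] does not mention the measurability of [f], which instance
   resolution needs in order to equip it with a measure structure. *)
Definition image_measure (_ : measurable_fun setT f) := pushforward nu f.

Let image0 : image_measure mf set0 = 0.
Proof. by rewrite /image_measure /pushforward preimage_set0 measure0. Qed.

Let image_ge0 A : 0 <= image_measure mf A.
Proof. exact: measure_ge0. Qed.

Let image_sigma_additive : semi_sigma_additive (image_measure mf).
Proof.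
by move=> F mF tF mUF; exact: (@measure_semi_sigma_additive _ _ _ (pushforward nu f)).
Qed.

HB.instance Definition _ := isMeasure.Build _ _ _ (image_measure mf)
  image0 image_ge0 image_sigma_additive.

Lemma ge0_integral_image (g : Y -> \bar R) : measurable_fun setT g ->
  (forall y, 0 <= g y) -> \int[image_measure mf]_y g y = \int[nu]_x g (f x).
Proof.
move=> mg g0.
have := @ge0_integral_pushforward _ _ _ _ _ _ mf nu setT g measurableT mg (fun y _ => g0 y).
by rewrite preimage_setT.
Qed.

Lemma integral_image (g : Y -> \bar R) : measurable_fun setT g ->
  nu.-integrable setT (g \o f) -> \int[image_measure mf]_y g y = \int[nu]_x g (f x).
Proof.
move=> mg ig.
have := @integral_pushforward _ _ _ _ _ _ mf nu setT g mg.
by rewrite preimage_setT; exact.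
Qed.

End image_measure.

Lemma sigma_finite_product d d' (X : measurableType d) (Y : measurableType d')
    (R : realType) (m1 : {sigma_finite_measure set X -> \bar R})
    (m2 : {sigma_finite_measure set Y -> \bar R}) : sigma_finite setT (m1 \x m2)%E.
Proof.
have /sigma_finiteP[F [TF ndF Foo]] := sigma_finiteT m1.
have /sigma_finiteP[G [TG ndG Goo]] := sigma_finiteT m2.
exists (fun n => F n `*` G n).
  apply/seteqP; split => // -[x y] _.
  have [i _ Fx] : (\bigcup_n F n) x by rewrite -TF.
  have [j _ Gy] : (\bigcup_n G n) y by rewrite -TG.
  exists (maxn i j) => //; split => /=.
    by move: x Fx; exact/subsetPset/ndF/leq_maxl.
  by move: y Gy; exact/subsetPset/ndG/leq_maxr.
move=> k; have [mF Fk] := Foo k; have [mG Gk] := Goo k.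
split; first exact: measurableX.
by rewrite product_measure1E// lte_mul_pinfty// ge0_fin_numE.
Qed.

Section lebesgue_rV.
Context {R : realType}.
Local Notation leb := (@lebesgue_measure R).

Definition rv_split m (x : 'rV[R]_m.+1) : R * 'rV[R]_m :=
  (x ord0 ord_max, \row_i x ord0 (widen_ord (leqnSn m) i)).

Lemma rv_ext_max m (v : 'rV[R]_m) t : rv_ext v t ord0 ord_max = t.
Proof. by rewrite mxE insubF //= ltnn. Qed.

Lemma rv_ext_widen m (v : 'rV[R]_m) t i :
  rv_ext v t ord0 (widen_ord (leqnSn m) i) = v ord0 i.
Proof. by rewrite mxE /= (insubT (fun k => k < m)%N (ltn_ord i)); congr (v _ _); apply: val_inj. Qed.

Lemma measurable_rv_split m : measurable_fun setT (@rv_split m).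
Proof.
apply/measurable_fun_pairP; split; first exact: measurable_coord.
apply: measurable_fun_rV => i.
rewrite (_ : (fun x => _) = (fun x : 'rV[R]_m.+1 => x ord0 (widen_ord (leqnSn m) i))).
  exact: measurable_coord.
by apply/funext => x /=; rewrite mxE.
Qed.

Lemma measurable_fun_rv_ext d (X : measurableType d) m (t : X -> R) (v : X -> 'rV[R]_m) :
  measurable_fun setT t -> measurable_fun setT v ->
  measurable_fun setT (fun x => rv_ext (v x) (t x)).
Proof.
move=> mt mv.
exact: (measurableT_comp (@measurable_rv_ext R m) (measurable_fun_pair mt mv)).
Qed.

Section step.
Variables (m : nat) (nu : {sigma_finite_measure set 'rV[R]_m -> \bar R}).

(** The appended coordinate is the first factor of the product, as in [iint], whose outermost
    integral is over the last coordinate. *)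
Definition ext_measure := image_measure (leb \x nu)%E (@measurable_rv_ext R m).

HB.instance Definition _ := Measure.on ext_measure.

Let ext_sigma_finite : sigma_finite setT ext_measure.
Proof.
have [F TF Foo] : sigma_finite setT (leb \x nu)%E by exact: (sigma_finite_product leb nu).
exists (fun k => @rv_split m @^-1` F k).
  by rewrite -preimage_bigcup -TF preimage_setT.
move=> k; have [mF Fk] := Foo k; split.
  by rewrite -[X in measurable X]setTI; exact: measurable_rv_split.
rewrite /ext_measure /image_measure /pushforward.
rewrite (_ : _ @^-1` _ = F k)//; apply/seteqP.
suff H (p : R * 'rV[R]_m) : rv_split (rv_ext p.2 p.1) = p.
  by split => p /=; rewrite H.
case: p => t v; rewrite /rv_split rv_ext_max; congr pair.
by apply/rowP => i; rewrite mxE rv_ext_widen.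
Qed.

HB.instance Definition _ := Measure_isSigmaFinite.Build _ _ _ ext_measure
  ext_sigma_finite.

End step.

(** The recursion returns a bundled sigma-finite measure, since the next product needs
    sigma-finiteness. In dimension 0 the Dirac mass at the only point matches [iint g = g 0]. *)
Fixpoint mu m : {sigma_finite_measure set 'rV[R]_m -> \bar R} :=
  match m with
  | 0 => \d_(0 : 'rV[R]_0)
  | k.+1 => ext_measure (mu k)
  end.

Local Arguments mu : simpl never.
Local Open Scope ereal_scope.

(** The induction enlarges the parameter space [X]: integration variables move into it. Neither sign
    nor integrability is assumed, so positive and negative parts go through Tonelli separately. *)
Lemma measurable_iint d (X : measurableType d) m (g : X * 'rV[R]_m -> \bar R) :
  measurable_fun setT g -> measurable_fun setT (fun x => iint (fun v => g (x, v))).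
Proof.
elim: m d X g => [|m IH] d X g mg /=.
  by apply: (measurableT_comp mg); exact: measurable_fun_pair.
pose G (p : X * R) := iint (fun v => g (p.1, rv_ext v p.2)).
have mG : measurable_fun setT G.
  apply: (IH _ _ (fun q : (X * R) * 'rV[R]_m => g (q.1.1, rv_ext q.2 q.1.2))).
  apply: (measurableT_comp mg); apply: measurable_fun_pair.
    exact: (measurableT_comp measurable_fst measurable_fst).
  apply: measurable_fun_rv_ext => //=.
  exact: (measurableT_comp measurable_snd measurable_fst).
rewrite (_ : (fun x => _) = (fun x => fubini_F leb (G^\+) x - fubini_F leb (G^\-) x)).
  apply: emeasurable_funB; apply: measurable_fun_fubini_tonelli_F => //.
    exact: measurable_funepos.
  exact: measurable_funeneg.
apply/funext => x; rewrite [LHS]integralE /fubini_F.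
by congr (_ - _); apply: eq_integral => t _; rewrite ?funeposE ?funenegE.
Qed.

Lemma ge0_integral_ext m (nu : {sigma_finite_measure set 'rV[R]_m -> \bar R})
    (g : 'rV[R]_m.+1 -> \bar R) : measurable_fun setT g -> (forall x, 0 <= g x) ->
  \int[ext_measure nu]_x g x = \int[leb]_t \int[nu]_v g (rv_ext v t).
Proof.
move=> mg g0; rewrite (ge0_integral_image (leb \x nu) (@measurable_rv_ext R m) mg g0).
apply: (@fubini_tonelli1 _ _ _ _ _ leb nu (fun p => g (rv_ext p.2 p.1))) => //.
exact: (measurableT_comp mg (@measurable_rv_ext R m)).
Qed.

Lemma integrable_ext m (nu : {sigma_finite_measure set 'rV[R]_m -> \bar R})
    (g : 'rV[R]_m.+1 -> \bar R) : (ext_measure nu).-integrable setT g ->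
  (leb \x nu).-integrable setT (fun p : R * 'rV[R]_m => g (rv_ext p.2 p.1)).
Proof.
move=> /integrableP[mg ig]; apply/integrableP; split.
  exact: (measurableT_comp mg (@measurable_rv_ext R m)).
apply: le_lt_trans ig; rewrite le_eqVlt; apply/orP; left; apply/eqP/esym.
apply: (ge0_integral_image (leb \x nu) (@measurable_rv_ext R m)
  (g := fun x => `|g x|)) => //.
exact: measurableT_comp.
Qed.

Lemma integral_ext m (nu : {sigma_finite_measure set 'rV[R]_m -> \bar R})
    (g : 'rV[R]_m.+1 -> \bar R) : (ext_measure nu).-integrable setT g ->
  \int[ext_measure nu]_x g x = \int[leb]_t \int[nu]_v g (rv_ext v t).
Proof.
move=> ig; have mg := measurable_int _ ig; have igr := integrable_ext ig.
rewrite (integral_image (nu := leb \x nu) (@measurable_rv_ext R m)) //.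
exact/esym/(@integral12_prod_meas1 _ _ _ _ _ leb nu (fun p => g (rv_ext p.2 p.1))).
Qed.

Lemma ge0_iint_mu m (g : 'rV[R]_m -> \bar R) : measurable_fun setT g ->
  (forall x, 0 <= g x) -> iint g = \int[mu m]_x g x.
Proof.
elim: m g => [|m IH] g mg g0.
  by rewrite /mu /= integral_dirac // diracT mul1e.
rewrite [RHS](ge0_integral_ext (mu m) mg g0) /=.
apply: eq_integral => t _; apply: IH => //.
by apply: (measurableT_comp mg); exact: measurable_fun_rv_ext.
Qed.

(** For a signed [g] the slices are integrable only for almost every [t], so the inner integrals are
    compared almost everywhere; [measurable_iint] provides the measurability that this comparison
    requires. *)
Lemma iint_mu m (g : 'rV[R]_m -> \bar R) : (mu m).-integrable setT g ->
  iint g = \int[mu m]_x g x.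
Proof.
elim: m g => [|m IH] g ig.
  by rewrite /mu /= integral_dirac // ?diracT ?mul1e //; exact: measurable_int ig.
have mg : measurable_fun setT g := measurable_int _ ig.
have igr := integrable_ext ig.
rewrite [RHS](integral_ext ig) /=.
apply: ae_eq_integral => //.
- apply: (@measurable_iint _ _ _ (fun q : R * 'rV[R]_m => g (rv_ext q.2 q.1))).
  exact: measurable_int igr.
- exact: (measurable_fubini_F igr).
- apply: filterS (ae_integrable1 igr) => t it _; exact: IH.
Qed.

End lebesgue_rV.

#[global] Arguments mu {R} m : simpl never.

Section mu_boxes.
Context {R : realType}.
Local Open Scope ereal_scope.

(** The maximum gives volume 0 to a box with a reversed side, so that [mu_box] holds for all
    corners. *)
Definition vol m (a b : 'rV[R]_m) : R := (\prod_i Num.max 0 (b ord0 i - a ord0 i))%R.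

Lemma mu0 A : mu 0 A = \d_(0%R : 'rV[R]_0) A.
Proof. by []. Qed.

Lemma muS m A : mu m.+1 A =
  (@lebesgue_measure R \x mu m) ((fun p => rv_ext p.2 p.1) @^-1` A).
Proof. by []. Qed.

Lemma mu_box m (a b : 'rV[R]_m) : mu m (box a b) = (vol a b)%:E.
Proof.
elim: m a b => [|m IH] a b.
  rewrite mu0 diracE mem_set; first by rewrite /vol big_ord0.
  by case.
rewrite muS.
pose w (c : 'rV[R]_m.+1) : 'rV[R]_m := (rv_split c).2.
rewrite (_ : _ @^-1` _ = `[a ord0 ord_max, b ord0 ord_max]%classic `*` box (w a) (w b)).
  rewrite product_measure1E //; last exact: measurable_box.
  rewrite [X in _ * X]IH [X in X * _]lebesgue_measure_itv /= /vol big_ord_recr /= EFinM muleC lte_fin.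
  congr (_ * _).
    by congr EFin; apply: eq_bigr => i _; rewrite !mxE.
  case: ltP => ab; first by rewrite max_r ?subr_ge0 ?(ltW ab).
  by rewrite max_l // subr_le0.
apply/seteqP; split => -[t v] /=.
  move=> H; split.
    by have := H ord_max; rewrite rv_ext_max in_itv.
  by move=> i; have := H (widen_ord (leqnSn m) i); rewrite rv_ext_widen !mxE.
move=> [H1 H2] i; have [->|ni] := eqVneq i ord_max.
  by rewrite rv_ext_max; move: H1; rewrite in_itv.
have im : (i < m)%N.
  rewrite ltn_neqAle -ltnS ltn_ord andbT; apply: contra ni => /eqP im.
  by apply/eqP/val_inj.
rewrite (_ : i = widen_ord (leqnSn m) (Ordinal im)); last exact: val_inj.
by rewrite rv_ext_widen; have := H2 (Ordinal im); rewrite !mxE.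
Qed.

Lemma mu_box_lty m (a b : 'rV[R]_m) : mu m (box a b) < +oo.
Proof. by rewrite mu_box ltry. Qed.

(** Boxes are stable under intersection, generate the Borel sets and contain an exhausting sequence
    of finite measure. Translation invariance and the identification of [box_outer] both rest on
    this. *)
Lemma mu_unique m (nu : {measure set 'rV[R]_m -> \bar R}) :
  (forall a b, nu (box a b) = mu m (box a b)) ->
  forall A, measurable A -> nu A = mu m A.
Proof.
move=> nuE A mA; apply/esym.
apply: (measure_unique _ (fun k => box (const_mx (- k%:R)%R) (const_mx k%:R))
  (measurable_rV_box m)) => //.
- move=> _ _ [a [b ->]] [c [d ->]]; rewrite boxI.
  by eexists; eexists.
- by move=> i; eexists; eexists.
- exact: bigcup_box_const.
- by move=> _ [a [b ->]]; rewrite nuE.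
- by move=> k; exact: mu_box_lty.
Qed.

Lemma measurable_shift m (v : 'rV[R]_m) : measurable_fun setT (fun x : 'rV[R]_m => (x + v)%R).
Proof.
apply: measurable_fun_rV => i; under eq_fun do rewrite mxE.
by apply: measurable_funD => //; exact: measurable_coord.
Qed.

Lemma mu_shift m (v : 'rV[R]_m) A : measurable A ->
  mu m ((fun x => (x + v)%R) @^-1` A) = mu m A.
Proof.
move=> mA; apply: (mu_unique (nu := image_measure (mu m) (measurable_shift v))) => //.
move=> a b; rewrite /= /image_measure /pushforward.
rewrite (_ : _ @^-1` _ = box (a - v)%R (b - v)%R).
  rewrite !mu_box; congr EFin; apply: eq_bigr => i _; rewrite !mxE.
  by congr Num.max; lra.
by apply/seteqP; split => x /= H i; have := H i; rewrite !mxE; lra.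
Qed.

Lemma ge0_integral_shift m (v : 'rV[R]_m) (g : 'rV[R]_m -> \bar R) :
  measurable_fun setT g -> (forall x, 0 <= g x) ->
  \int[mu m]_x g (x + v)%R = \int[mu m]_x g x.
Proof.
move=> mg g0.
rewrite -[RHS](@eq_measure_integral _ _ _ _ _ (image_measure (mu m) (measurable_shift v))).
  by rewrite (ge0_integral_image (mu m) (measurable_shift v)).
by move=> A mA _; exact: mu_shift.
Qed.

Lemma integrable_shift m (v : 'rV[R]_m) (g : 'rV[R]_m -> \bar R) :
  (mu m).-integrable setT g -> (mu m).-integrable setT (fun x => g (x + v)%R).
Proof.
move=> /integrableP[mg ig]; apply/integrableP; split.
  exact: (measurableT_comp mg (measurable_shift v)).
rewrite (ge0_integral_shift v (g := fun x => `|g x|)) //.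
exact: measurableT_comp.
Qed.

Lemma integral_shift m (v : 'rV[R]_m) (g : 'rV[R]_m -> \bar R) :
  (mu m).-integrable setT g -> \int[mu m]_x g (x + v)%R = \int[mu m]_x g x.
Proof.
move=> ig.
rewrite -[RHS](@eq_measure_integral _ _ _ _ _ (image_measure (mu m) (measurable_shift v))).
  rewrite (integral_image (nu := mu m) (measurable_shift v)) //.
    exact: measurable_int ig.
  exact: integrable_shift.
by move=> A mA _; exact: mu_shift.
Qed.

Lemma ae_shift m (v : 'rV[R]_m) (P : 'rV[R]_m -> Prop) :
  {ae mu m, forall x, P x} -> {ae mu m, forall x, P (x + v)%R}.
Proof.
move=> [A [mA A0 PA]]; exists ((fun x => (x + v)%R) @^-1` A); split.
- by rewrite -[X in measurable X]setTI; exact: measurable_shift.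
- by rewrite mu_shift.
- by move=> x Px; exact: PA.
Qed.

End mu_boxes.

(** * Null sets *)

Section null_sets.
Context {R : realType} (m : nat).
Local Open Scope ereal_scope.
Local Notation T := 'rV[R]_m.

(** The empty set is listed apart because in dimension 0 no box is empty. *)
Definition is_box (A : set T) := A = set0 \/ exists a b, A = box a b.

(** The value [+oo] off boxes turns [mu_ext], an infimum over covers by measurable sets, into an
    infimum over covers by boxes. *)
Definition box_weight (A : set T) : \bar R :=
  if `[< is_box A >] then mu m A else +oo.

Lemma box_weight0 : box_weight set0 = 0.
Proof. by rewrite /box_weight asboolT ?measure0 //; left. Qed.

Lemma box_weight_ge0 A : 0 <= box_weight A.
Proof. by rewrite /box_weight; case: ifP. Qed.

Lemma box_weightE A : is_box A -> box_weight A = mu m A.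
Proof. by move=> ?; rewrite /box_weight asboolT. Qed.

Lemma le_mu_box_weight A : mu m A <= box_weight A.
Proof. by rewrite /box_weight; case: ifP => _ //; rewrite leey. Qed.

Definition box_outer : set T -> \bar R := mu_ext box_weight.

HB.instance Definition _ := isOuterMeasure.Build R T box_outer
  (mu_ext0 box_weight0 box_weight_ge0) (mu_ext_ge0 box_weight_ge0)
  (le_mu_ext box_weight) (mu_ext_sigma_subadditive box_weight_ge0).

Lemma le_mu_box_outer A : measurable A -> mu m A <= box_outer A.
Proof.
move=> mA; apply: le_ereal_inf_tmp => _ [F [mF AF] <-].
apply: le_trans (measure_sigma_subadditive (mu m) mF mA AF) _.
by apply: lee_nneseries => // k _; exact: le_mu_box_weight.
Qed.

Lemma box_outer_box a b : box_outer (box a b) = mu m (box a b).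
Proof.
apply/eqP; rewrite eq_le le_mu_box_outer ?andbT; last exact: measurable_box.
apply: ereal_inf_lbound; exists (fun k => if k is 0%N return set T then box a b else set0).
  split; first by case=> [|k]; [exact: measurable_box|].
  by move=> x xab; exists 0%N.
rewrite nneseries_recl //; last by move=> k _; exact: box_weight_ge0.
rewrite eseries0 ?adde0 => [|[|k] //= _ _]; last exact: box_weight0.
by rewrite box_weightE //; right; exists a, b.
Qed.

Let halfspace (i : 'I_m) (c : R) : set T := [set x | x ord0 i <= c]%R.

Lemma caratheodory_halfspace i c : box_outer.-caratheodory (halfspace i c).
Proof.
apply: le_caratheodory_measurable => X.
apply: le_ereal_inf_tmp => _ [F [mF XF] <-].
(* The complement is covered by the closed half-space, so that both pieces of a box are closed
   boxes; the face they share has volume 0. *)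
pose H' : set T := [set x | c <= x ord0 i]%R.
have mH : measurable (halfspace i c).
  by rewrite -[X in measurable X]setTI; apply: measurable_fun_le => //; exact: measurable_coord.
have mH' : measurable H'.
  by rewrite -[X in measurable X]setTI; apply: measurable_fun_le => //; exact: measurable_coord.
apply: (@le_trans _ _ (\sum_(k <oo) (box_weight (F k `&` halfspace i c) + box_weight (F k `&` H')))).
  rewrite nneseriesD; [|by move=> *; exact: box_weight_ge0..].
  apply: leeD; apply: ereal_inf_lbound.
    exists (fun k => F k `&` halfspace i c) => //; split.
      by move=> k; apply: measurableI.
    by move=> x [/XF[k _ Fx] Hx]; exists k.
  exists (fun k => F k `&` H') => //; split.
    by move=> k; apply: measurableI.
  move=> x [/XF[k _ Fx] Hx]; exists k => //; split => //.
  by move: Hx => /negP; rewrite /halfspace /= -ltNge /H' /= => /ltW.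
apply: lee_nneseries => [k _ _|k _]; first by rewrite adde_ge0 ?box_weight_ge0.
rewrite [leRHS]/box_weight; case: asboolP => [|_]; last by rewrite leey.
move=> [->|[a [b Fab]]]; first by rewrite !set0I box_weight0 adde0.
pose b' : T := \row_j (if j == i then Num.min (b ord0 i) c else b ord0 j)%R.
pose a' : T := \row_j (if j == i then Num.max (a ord0 i) c else a ord0 j)%R.
have E1 : F k `&` halfspace i c = box a b'.
  rewrite Fab; apply/seteqP; split => x /=.
    move=> [xab /= xc] j; rewrite mxE; have := xab j.
    by case: eqP => [->|_ //]; rewrite le_min xc andbT.
  move=> H; split => [j|].
    have := H j; rewrite mxE; case: eqP => [->|_ //]; rewrite le_min; lra.
  by have := H i; rewrite mxE eqxx le_min /halfspace /=; lra.
have E2 : F k `&` H' = box a' b.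
  rewrite Fab; apply/seteqP; split => x /=.
    move=> [xab /= xc] j; rewrite mxE; have := xab j.
    by case: eqP => [->|_ //]; rewrite ge_max /H' /= in xc *; rewrite xc andbT.
  move=> H; split => [j|].
    have := H j; rewrite mxE; case: eqP => [->|_ //]; rewrite ge_max; lra.
  by have := H i; rewrite mxE eqxx ge_max /H' /=; lra.
rewrite !box_weightE; [|by right; exists a', b|by right; exists a, b'].
rewrite E1 E2 Fab !mu_box -EFinD lee_fin /vol (bigD1 i) //= [X in (_ + X <= _)%R](bigD1 i) //=.
rewrite [leRHS](bigD1 i) //= !mxE eqxx.
rewrite (eq_bigr (fun j => Num.max 0 (b ord0 j - a ord0 j)))%R; last first.
  by move=> j ji; rewrite !mxE (negPf ji).
rewrite [X in (_ + _ * X <= _)%R](eq_bigr (fun j => Num.max 0 (b ord0 j - a ord0 j)))%R; last first.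
  by move=> j ji; rewrite !mxE (negPf ji).
rewrite -mulrDl ler_wpM2r //; first by rewrite prodr_ge0 // => j _; rewrite le_max lexx.
move: (a ord0 i) (b ord0 i) => p q; rewrite !maxEle !minEle.
do ![case: ifPn => ?]; lra.
Qed.

Lemma box_outer_caratheodory A : measurable A -> box_outer.-caratheodory A.
Proof.
rewrite measurable_rV_box.
apply: (smallest_sub (C := sigma_algebra setT)).
  split.
  - exact: caratheodory_measurable_set0.
  - by move=> B cB; rewrite setTD; exact: caratheodory_measurable_setC.
  - exact: caratheodory_measurable_bigcup.
move=> _ [a [b ->]].
(* Only the half-spaces [x i <= c] have been treated; [a i <= x i] is recovered from the complements
   of those at [a i - 1/(k+1)]. *)
rewrite (_ : box a b = \bigcap_(i in [set: 'I_m])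
  (halfspace i (b ord0 i) `&` \bigcap_k ~` halfspace i (a ord0 i - k.+1%:R^-1)%R)); last first.
  apply/seteqP; split => x xab i.
    move=> _; split; first by rewrite /halfspace /=; case/andP: (xab i).
    move=> k _; rewrite /halfspace /=; apply/negP; rewrite -ltNge.
    have /andP[+ _] := xab i; apply: lt_le_trans.
    by rewrite ltrBlDr ltrDl invr_gt0.
  have [/= xb xa] := xab i I; rewrite /halfspace /= in xb; rewrite xb andbT.
  apply/ler_addgt0Pr => e e0; have [k _ ke] := near_infty_natSinv_lt (PosNum e0).
  have /negP := xa k I; rewrite /halfspace /= -ltNge => H.
  have ke' : (k.+1%:R^-1 < e)%R := ke k (leqnn k).
  move: H ke'; move: (k.+1%:R^-1)%R => q; lra.
have cI (I : choiceType) (D : set I) (F : I -> set T) : finite_set D ->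
    (forall i, D i -> box_outer.-caratheodory (F i)) ->
    box_outer.-caratheodory (\bigcap_(i in D) F i).
  move=> Dfin cF; apply: (@fin_bigcap_measurable _ (caratheodory_type box_outer)) => //.
apply: cI => [|i _]; first exact: finite_finset.
apply: caratheodory_measurable_setI; first exact: caratheodory_halfspace.
apply: (@bigcapT_measurable _ (caratheodory_type box_outer)) => k.
exact/caratheodory_measurable_setC/caratheodory_halfspace.
Qed.

Definition box_measure (A : set T) := box_outer A.

Let box_measure0 : box_measure set0 = 0.
Proof. exact: outer_measure0. Qed.

Let box_measure_ge0 A : 0 <= box_measure A.
Proof. exact: outer_measure_ge0. Qed.

Let box_measure_sigma_additive : semi_sigma_additive box_measure.
Proof.
move=> F mF tF mUF; apply: caratheodory_measure_sigma_additive => //.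
  by move=> k; exact: box_outer_caratheodory.
exact: box_outer_caratheodory.
Qed.

HB.instance Definition _ := isMeasure.Build _ _ _ box_measure
  box_measure0 box_measure_ge0 box_measure_sigma_additive.

Lemma box_outerE A : measurable A -> box_outer A = mu m A.
Proof. by apply: (mu_unique (nu := box_measure)); exact: box_outer_box. Qed.

Lemma negligible_lnull (N : set T) : (0 < m)%N -> (mu m).-negligible N -> lnull N.
Proof.
move=> m0 [A [mA A0 NA]] e e0.
have : box_outer A < e%:E by rewrite box_outerE // A0 lte_fin.
move=> /ereal_inf_lt[_ [F [mF AF] <-] Fe].
(* Finite total weight forces every member of the cover to be a box or empty. *)
have Ffin k : box_weight (F k) < +oo.
  apply: le_lt_trans (lt_trans Fe (ltry e)).
  rewrite (@nneseries_split _ _ 0%N k.+1) //; last by move=> *; exact: box_weight_ge0.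
  rewrite big_nat_recr //= add0n -addeA addeCA leeDl // adde_ge0 ?sume_ge0 //.
    by move=> *; exact: box_weight_ge0.
  by apply: nneseries_ge0 => *; exact: box_weight_ge0.
have Fbox k : exists ab : T * T, [/\ forall i, (ab.1 ord0 i <= ab.2 ord0 i)%R,
    F k `<=` box ab.1 ab.2 &
    ((\prod_i (ab.2 ord0 i - ab.1 ord0 i))%R)%:E = box_weight (F k)].
  (* An empty member becomes the degenerate box at the origin, of volume 0 because there is at least
     one coordinate. *)
  have [Fk0|/set0P[x Fx]] := eqVneq (F k) set0.
    exists (0%R, 0%R); split => //=; first by rewrite Fk0; exact: sub0set.
    rewrite Fk0 box_weight0 (bigD1 (Ordinal m0)) //= subrr mul0r //.
  have := Ffin k; rewrite /box_weight; case: asboolP => // -[Fk0|[a [b Fab]]] _.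
    by rewrite Fk0 in Fx.
  rewrite Fab; have ab i : (a ord0 i <= b ord0 i)%R.
    by rewrite Fab in Fx; have := Fx i; lra.
  exists (a, b); split => //=; rewrite mu_box; congr EFin.
  by apply: eq_bigr => i _; rewrite max_r // subr_ge0.
have [ab abP] := choice Fbox.
exists (fun k => (ab k).1), (fun k => (ab k).2); split; [|split].
- by move=> k i; have [+ _ _] := abP k; exact.
- move=> x /NA/AF[k _ Fx]; exists k => //; have [_ + _] := abP k; exact.
- apply: le_lt_trans Fe; rewrite le_eqVlt; apply/orP; left; apply/eqP.
  by apply: eq_eseriesr => k _; have [_ _] := abP k.
Qed.

Lemma lnull_negligible (N : set T) : lnull N -> (mu m).-negligible N.
Proof.
move=> N0.
have /choice[ab abP] (n : nat) : exists ab : (nat -> T) * (nat -> T),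
    N `<=` \bigcup_k box (ab.1 k) (ab.2 k) /\
    \sum_(0 <= k <oo) (mu m (box (ab.1 k) (ab.2 k))) < (n.+1%:R^-1)%:E.
  have [|a [b [ab [Nab abn]]]] := N0 (n.+1%:R^-1)%R; first by rewrite invr_gt0.
  exists (a, b); split => //=; apply: le_lt_trans abn.
  rewrite le_eqVlt; apply/orP; left; apply/eqP.
  apply: eq_eseriesr => k _; rewrite mu_box; congr EFin; apply: eq_bigr => i _.
  by rewrite max_r // subr_ge0.
pose B n := \bigcup_k box ((ab n).1 k) ((ab n).2 k).
have mB n : measurable (B n) by apply: bigcupT_measurable => k; exact: measurable_box.
exists (\bigcap_n B n); split.
- exact: bigcapT_measurable.
- apply/eqP; rewrite eq_le measure_ge0 andbT.
  apply/lee_addgt0Pr => e e0; rewrite add0e.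
  have [n _ ne] := near_infty_natSinv_lt (PosNum e0).
  apply: (@le_trans _ _ (n.+1%:R^-1)%:E); last by rewrite lee_fin ltW // (ne n) /=.
  apply: le_trans (ltW (abP n).2).
  apply: measure_sigma_subadditive.
  + by move=> k; exact: measurable_box.
  + exact: bigcapT_measurable.
  + by move=> x /(_ n I).
- by move=> x Nx n _; exact: (abP n).1.
Qed.

End null_sets.

(** * Test functions *)

Section smooth1.
Context {R : realType}.
Implicit Types g : R -> R.

(** Derivatives are carried as witnesses, so closure under sums, products and affine changes of
    variable is an induction on [k]; uniqueness of derivatives glues the witnesses for all [k] in
    [smooth1_derive]. *)
Fixpoint Ck (k : nat) g : Prop :=
  if k is k'.+1 then exists g', (forall x : R, is_derive x 1 g (g' x)) /\ Ck k' g' else True.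

Definition smooth1 g := forall k, Ck k g.

Lemma CkS k g : Ck k.+1 g -> Ck k g.
Proof.
elim: k g => [//|k IH] g [g' [dg Cg']].
by exists g'; split => //; exact: IH.
Qed.

Lemma smooth1_derive g : smooth1 g ->
  exists g', (forall x : R, is_derive x 1 g (g' x)) /\ smooth1 g'.
Proof.
move=> sg; have [g' [dg _]] := sg 1%N; exists g'; split => // k.
have [g'' [dg' +]] := sg k.+1; suff -> : g' = g'' by [].
apply/funext => x; rewrite -(@derive_val _ _ _ _ _ _ _ (dg x)).
exact: (@derive_val _ _ _ _ _ _ _ (dg' x)).
Qed.

Lemma smooth1_antiderivative g g' :
  (forall x : R, is_derive x 1 g (g' x)) -> smooth1 g' -> smooth1 g.
Proof. by move=> dg sg' [//|k]; exists g'. Qed.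

Lemma smooth1_continuous g : smooth1 g -> continuous g.
Proof.
move=> /smooth1_derive[g' [dg _]] x.
by apply: differentiable_continuous; apply/derivable1_diffP; have [] := dg x.
Qed.

Lemma CkD k f g : Ck k f -> Ck k g -> Ck k (f + g).
Proof.
elim: k f g => [//|k IH] f g [f' [df Cf]] [g' [dg Cg]].
by exists (f' + g'); split => [x|]; [exact: is_deriveD|exact: IH].
Qed.

Lemma CkM k f g : Ck k f -> Ck k g -> Ck k (f * g).
Proof.
elim: k f g => [//|k IH] f g Cf Cg; have := Cf; have := Cg.
move=> [g' [dg Cg']] [f' [df Cf']]; exists (f * g' + g * f'); split => [x|].
  exact: is_deriveM.
by apply: CkD; apply: IH => //; exact: CkS.
Qed.

Lemma Ck_cst k c : Ck k (cst c).
Proof. by elim: k c => [//|k IH] c; exists (cst 0); split => // x; exact: is_derive_cst. Qed.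

Lemma Ck_affine k g c d : Ck k g -> Ck k (fun x => g (c * x + d)).
Proof.
elim: k g => [//|k IH] g [g' [dg Cg']].
exists ((fun x => g' (c * x + d)) * cst c); split; last by apply: CkM; [exact: IH|exact: Ck_cst].
move=> x; apply: (@is_derive1_comp _ g (fun x => c * x + d)) => //.
have H : is_derive x 1 ((c \*: id : R -> R) + cst d) (c *: 1 + 0).
  exact: is_deriveD.
by apply: is_derive_eq H _; rewrite addr0 /GRing.scale /= mulr1.
Qed.

Lemma smooth1M f g : smooth1 f -> smooth1 g -> smooth1 (f * g).
Proof. by move=> sf sg k; exact: CkM. Qed.

Lemma smooth1D f g : smooth1 f -> smooth1 g -> smooth1 (f + g).
Proof. by move=> sf sg k; exact: CkD. Qed.

Lemma smooth1_affine g c d : smooth1 g -> smooth1 (fun x => g (c * x + d)).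
Proof. by move=> sg k; exact: Ck_affine. Qed.

(** The classical flat function [exp(-1/x)], with a polynomial in [1/x] as a factor so that the
    family is closed under differentiation. *)
Definition expV (p : {poly R}) (x : R) : R :=
  if 0 < x then p.[x^-1] * expR (- x^-1) else 0.

Lemma horner_expRN_bounded (p : {poly R}) :
  exists2 C, 0 <= C & forall y, 0 < y -> `|p.[y] * expR (- y)| <= C.
Proof.
have mono n : exists2 C : R, 0 <= C & forall y : R, 0 < y -> `|y ^+ n * expR (- y)| <= C.
  case: n => [|n].
    exists 1 => // y y0; rewrite expr0 mul1r ger0_norm ?expR_ge0 //.
    by rewrite -expR0 ler_expR; lra.
  exists (n.+1`!%:R) => // y y0.
  rewrite ger0_norm; last by rewrite mulr_ge0 ?expR_ge0 // exprn_ge0 // ltW.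
  rewrite expRN ler_pdivrMr ?expR_gt0 // mulrC.
  have := expR_ge1Dxn n (ltW y0).
  rewrite -ler_pdivrMr ?ltr0n ?fact_gt0 //; lra.
elim/poly_ind: p => [|p c [C C0 IH]].
  by exists 0 => // y _; rewrite horner0 mul0r normr0.
(* The factor [y ^+ n] makes the induction work: peeling off the constant term of [p] raises the
   exponent by one. *)
have {C C0 IH} : forall n, exists2 C, 0 <= C & forall y, 0 < y -> `|(y ^+ n * p.[y]) * expR (- y)| <= C.
  elim/poly_ind: {C C0 IH} p => [|p d IH] n.
    by exists 0 => // y _; rewrite horner0 mulr0 mul0r normr0.
  have [C C0 HC] := IH n.+1; have [D D0 HD] := mono n.
  exists (C + D * `|d|) => [|y y0]; first by rewrite addr_ge0 // mulr_ge0.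
  have -> : y ^+ n * (p * 'X + d%:P).[y] * expR (- y) =
      y ^+ n.+1 * p.[y] * expR (- y) + y ^+ n * expR (- y) * d.
    by rewrite !hornerE exprS; ring.
  apply: le_trans (ler_normD _ _) _; apply: lerD; first exact: HC.
  by rewrite normrM ler_wpM2r // HD.
move=> /(_ 1%N)[C C0 HC]; have [D D0 HD] := mono 0%N.
exists (C + D * `|c|) => [|y y0]; first by rewrite addr_ge0 // mulr_ge0.
have -> : (p * 'X + c%:P).[y] * expR (- y) =
    y ^+ 1 * p.[y] * expR (- y) + y ^+ 0 * expR (- y) * c.
  by rewrite !hornerE; ring.
apply: le_trans (ler_normD _ _) _; apply: lerD; first exact: HC.
by rewrite normrM ler_wpM2r // HD.
Qed.

Lemma is_derive_expV (p : {poly R}) (x : R) : is_derive x 1 (expV p) (expV ('X^2 * (p - p^`())) x).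
Proof.
have [x0|x0|x0] := ltgtP x 0.
- apply: (@near_eq_is_derive _ _ _ (cst 0)).
    near=> y; rewrite /expV ltNge (_ : y <= 0) //; apply: ltW; near: y.
    exact: lt_nbhsl.
  by rewrite /expV ltNge (ltW x0) /=; exact: is_derive_cst.
- rewrite /(expV _ x) x0.
  apply: (@near_eq_is_derive _ _ _ (fun y : R => p.[y^-1] * expR (- y^-1))).
    near=> y; rewrite /expV (_ : 0 < y) //; near: y; exact: lt_nbhsr.
  have dV : is_derive x 1 (fun y : R => y^-1) (- x ^- 2 *: 1).
    by apply: (@is_deriveV _ id) => //; rewrite gt_eqF.
  have dp : is_derive x 1 (fun y : R => p.[y^-1]) (p^`().[x^-1] * (- x ^- 2 *: 1)).
    exact: (@is_derive1_comp _ (horner p) (fun y => y^-1)).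
  have de : is_derive x 1 (fun y : R => expR (- y^-1)) (expR (- x^-1) * - (- x ^- 2 *: 1)).
    exact: (@is_derive1_comp _ expR (fun y => - y^-1)).
  apply: is_derive_eq (is_deriveM dp de) _.
  rewrite !hornerE /GRing.scale /= !mulr1 exprVn; ring.
- rewrite x0 /(expV _ 0) ltxx.
  (* The extra ['X^2] gives [|expV p h| <= C h^2], better than the [o(h)] that makes the derivative
     at 0 vanish. *)
  have [C C0 HC] := horner_expRN_bounded ('X^2 * p).
  have bnd h : `|expV p h| <= C * h ^+ 2.
    rewrite /expV; case: ifPn => [h0|_]; last by rewrite normr0 mulr_ge0 // sqr_ge0.
    have := HC h^-1; rewrite invr_gt0 => /(_ h0); rewrite hornerM hornerXn.
    rewrite exprVn -mulrA normrM (ger0_norm (x := h ^- 2)) ?invr_ge0 ?sqr_ge0 //.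
    have h2 : 0 < h ^+ 2 by exact: exprn_gt0.
    by move=> H; move: H; rewrite [X in X <= C -> _]mulrC (ler_pdivrMr _ _ h2).
  have cv : (fun h : R => h^-1 *: ((expV p \o shift 0) (h *: 1) - expV p 0)) @ 0^' --> (0 : R).
    apply/cvgr0Pnorm_lt => e e0; near=> h.
    have h0 : h != 0 by near: h; exact: nbhs_dnbhs_neq.
    rewrite /= addr0 {2}/expV ltxx subr0 /GRing.scale /= mulr1 normrM normfV.
    rewrite mulrC ltr_pdivrMr ?normr_gt0 //.
    apply: le_lt_trans (bnd h) _.
    rewrite -real_normK ?num_real // expr2 mulrA ltr_pM2r ?normr_gt0 //.
    have he : `|h| < e / (C + 1).
      near: h; apply: dnbhs0_lt; apply: divr_gt0 => //; lra.
    apply: (@le_lt_trans _ _ ((C + 1) * `|h|)).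
      by rewrite ler_wpM2r //; lra.
    by rewrite mulrC -ltr_pdivlMr //; lra.
  apply: DeriveDef; first by apply/cvg_ex; exists 0.
  exact/cvg_lim.
Unshelve. all: by end_near. Qed.

Lemma smooth1_expV p : smooth1 (expV p).
Proof.
move=> k; elim: k p => [//|k IH] p.
by exists (expV ('X^2 * (p - p^`()))); split => // x; exact: is_derive_expV.
Qed.

(** Since [expV 1] tends to 1 at infinity, these functions converge to the indicator of the open
    interval as [n] grows. The affine arguments are expanded to suit [smooth1_affine]. *)
Definition bump (a b : R) (n : nat) (t : R) : R :=
  expV 1 (n.+1%:R * t + n.+1%:R * - a) * expV 1 (- n.+1%:R * t + n.+1%:R * b).

Lemma smooth1_bump a b n : smooth1 (bump a b n).
Proof. by apply: smooth1M; apply: smooth1_affine; exact: smooth1_expV. Qed.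

Lemma expV1_itv x : 0 <= expV 1 x <= 1.
Proof.
rewrite /expV; case: ifPn => x0; last by lra.
rewrite hornerE mul1r expR_ge0 /= -expR0 ler_expR.
by rewrite oppr_le0 invr_ge0 ltW.
Qed.

Lemma bump_itv a b n t : 0 <= bump a b n t <= 1.
Proof.
have := expV1_itv (n.+1%:R * t + n.+1%:R * - a).
have := expV1_itv (- n.+1%:R * t + n.+1%:R * b).
rewrite /bump => /andP[? ?] /andP[? ?]; rewrite mulr_ge0 //=.
exact: mulr_ile1.
Qed.

Lemma bump_out a b n t : ~~ (a < t < b) -> bump a b n t = 0.
Proof.
rewrite negb_and -!leNgt => /orP[] H; rewrite /bump.
  rewrite {1}/expV ltNge (_ : _ <= 0) ?mul0r //.
  by rewrite -mulrDr pmulr_rle0 //; lra.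
rewrite [X in _ * X]/expV ltNge (_ : _ <= 0) ?mulr0 //.
by rewrite mulNr -mulrN -mulrDr pmulr_rle0 //; lra.
Qed.

Lemma expV1_cvg (d : R) : 0 < d -> (fun n => expV 1 (n.+1%:R * d)) @ \oo --> (1 : R).
Proof.
move=> d0.
have -> : (fun n : nat => expV 1 (n.+1%:R * d)) = (fun n : nat => expR (- (d^-1 * n.+1%:R^-1))).
  apply/funext => n; rewrite /expV pmulr_rgt0 // d0 hornerE mul1r.
  by rewrite invfM mulrC.
have cv : (fun n : nat => - (d^-1 * n.+1%:R^-1)) @ \oo --> (- (d^-1 * 0) : R).
  by apply: cvgN; apply: cvgM; [exact: cvg_cst|exact: cvg_harmonic].
rewrite mulr0 oppr0 in cv.
have := @cvg_comp _ _ _ _ expR _ _ _ cv (@continuous_expR R 0).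
by rewrite expR0; exact.
Qed.

Lemma bump_cvg a b t : a < t < b -> (fun n => bump a b n t) @ \oo --> (1 : R).
Proof.
move=> /andP[at_ tb].
suff : (fun n => bump a b n t) @ \oo --> (1 * 1 : R) by rewrite mulr1.
apply: cvgM.
  have := @expV1_cvg (t - a); rewrite subr_gt0 => /(_ at_).
  by under eq_fun do rewrite mulrBr -mulrN.
have := @expV1_cvg (b - t); rewrite subr_gt0 => /(_ tb).
by under eq_fun do rewrite mulrBr addrC -mulNr.
Qed.

End smooth1.

Section primitive.
Context {R : realType}.
Local Notation leb := (@lebesgue_measure R).

Lemma exists_primitive (g : R -> R) (a b : R) : continuous g ->
  (forall t, ~~ (a < t < b) -> g t = 0) ->
  exists H : R -> R, forall x : R, is_derive x 1 H (g x).
Proof.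
move=> cg g0.
have ig : leb.-integrable setT (EFin \o g).
  rewrite (_ : EFin \o g = (EFin \o g) \_ `[a, b]).
    rewrite -integrable_mkcond //.
    apply: continuous_compact_integrable; first exact: segment_compact.
    exact: continuous_subspaceT.
  apply/funext => t; rewrite patchE; case: ifPn => //=.
  rewrite notin_setE /= in_itv /= => /negP tab; rewrite g0 //.
  by apply: contra tab => /andP[/ltW -> /ltW ->].
exists (fun y => \int[leb]_(t in `]-oo, y]) g t)%R => x.
have xu : x < x + 1 by rewrite ltrDl.
have ix : leb.-integrable [set` Interval -oo%O (BRight (x + 1))] (EFin \o g).
  by apply: integrableS ig.
have [dH <-] := continuous_FTC1 xu ix (ltNyr _) (cg x).
by split; [exact: dH|rewrite derive1E].
Qed.

(** [th] is the convolution of [g] with the indicator of [[0, s]]. Its derivative is a finite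
    difference, which turns a weak derivative tested against it into an increment of the
    function. *)
Lemma exists_difference_primitive (g : R -> R) (a b s : R) : smooth1 g -> 0 < s ->
  (forall t, ~~ (a < t < b) -> g t = 0) ->
  exists th : R -> R, [/\ smooth1 th,
    forall t : R, is_derive t 1 th (g t - g (t - s)) &
    forall t : R, (\int[leb]_(r in `[0%R, s]) (g (t - r)%R)%:E = (th t)%:E)%E].
Proof.
move=> sg s0 g0; have [H dH] := exists_primitive (smooth1_continuous sg) g0.
have sH := smooth1_antiderivative dH sg.
have daff (c d : R) (x : R) : is_derive x 1 (fun y => H (c * y + d)) (g (c * x + d) * c).
  apply: (@is_derive1_comp _ H (fun y => c * y + d)) => //.
  have K : is_derive x 1 ((c \*: id : R -> R) + cst d) (c *: 1 + 0) by exact: is_deriveD.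
  by apply: is_derive_eq K _; rewrite addr0 /GRing.scale /= mulr1.
pose th : R -> R := H + (fun x => -1) * (fun x => H (1 * x + - s)).
have thE t : th t = H t - H (t - s).
  by rewrite -[th t]/(H t + -1 * H (1 * t + - s)) mul1r mulN1r.
have dth (t : R) : is_derive t 1 th (g t - g (t - s)).
  have K : is_derive t 1 th (g t + ((cst (-1) : R -> R) t *: (g (1 * t + - s) * 1) + H (1 * t + - s) *: 0)).
    by apply: is_deriveD => //; apply: is_deriveM => //; exact: daff.
  by apply: is_derive_eq K _; rewrite /GRing.scale /= mulr0 addr0 mul1r mulr1 mulN1r.
exists th; split => //.
- apply: smooth1D => //; apply: smooth1M; first by move=> k; exact: Ck_cst.
  exact: smooth1_affine.
- move=> t.
  pose F (r : R) := - H (-1 * r + t).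
  have dF (r : R) : is_derive r 1 F (g (t - r)).
    have K : is_derive r 1 F (- (g (-1 * r + t) * -1)) by apply: is_deriveN; exact: daff.
    by apply: is_derive_eq K _; rewrite mulN1r mulrN1 opprK addrC.
  rewrite (@continuous_FTC2 _ _ F) //.
  + rewrite thE /F -EFinB !mulN1r oppr0 add0r opprK; congr EFin.
    by rewrite addrC (addrC (- s)).
  + apply: continuous_subspaceT => x.
    apply: (@continuous_comp _ _ _ (fun r => t - r) g); last exact: smooth1_continuous.
    by apply: continuousB; [exact: cst_continuous|exact: id].
  + have cF x : {for x, continuous F}.
      by apply: differentiable_continuous; apply/derivable1_diffP; have [] := dF x.
    split => [x _||].
    * by have [] := dF x.
    * exact/cvg_at_right_filter/cF.
    * exact/cvg_at_left_filter/cF.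
  + by move=> x _; rewrite derive1E; exact: (@derive_val _ _ _ _ _ _ _ (dF x)).
Qed.

End primitive.

(** * Products of one-variable functions *)

Section product_test_functions.
Context {R : realType} (m : nat).
Implicit Types eta : 'I_m -> R -> R.

Definition prodf eta (x : 'rV[R]_m) : R := \prod_k eta k (x ord0 k).

Definition upd eta (i : 'I_m) (g : R -> R) : 'I_m -> R -> R :=
  fun k => if k == i then g else eta k.

Lemma prodf_upd eta i g x :
  prodf (upd eta i g) x = g (x ord0 i) * \prod_(k | k != i) eta k (x ord0 k).
Proof.
rewrite /prodf (bigD1 i) //= /upd eqxx; congr (_ * _).
by apply: eq_bigr => k /negPf ->.
Qed.

Lemma continuous_prodf eta : (forall k, continuous (eta k)) -> continuous (prodf eta).
Proof.
move=> ceta x; rewrite /prodf.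
have H (s : seq 'I_m) : continuous (fun x : 'rV[R]_m => \prod_(k <- s) eta k (x ord0 k)).
  elim: s => [|k s IH] y.
    rewrite (_ : (fun x => _) = cst 1); first exact: cst_continuous.
    by apply/funext => z; rewrite big_nil.
  rewrite (_ : (fun x => _) = (fun z : 'rV[R]_m => eta k (z ord0 k) * \prod_(j <- s) eta j (z ord0 j))).
    apply: continuousM; last exact: IH.
    apply: (@continuous_comp _ _ _ (fun z : 'rV[R]_m => z ord0 k) (eta k)); last exact: ceta.
    exact: coord_continuous.
  by apply/funext => z; rewrite big_cons.
exact: H.
Qed.

Lemma is_derive_prodf eta i (g' : R -> R) : 
  (forall t : R, is_derive t 1 (eta i) (g' t)) ->
  forall x, is_derive x (@ebasis R m i) (prodf eta) (prodf (upd eta i g') x).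
Proof.
move=> dg x.
have [dv dE] := dg (x ord0 i).
have E : (fun h : R => h^-1 *: ((prodf eta \o shift x) (h *: @ebasis R m i) - prodf eta x)) =
   (fun h : R => (h^-1 *: ((eta i \o shift (x ord0 i)) (h *: 1) - eta i (x ord0 i))) *
       \prod_(k | k != i) eta k (x ord0 k)).
  apply/funext => h /=; rewrite /prodf (bigD1 i) //= [X in _ - X](bigD1 i) //=.
  rewrite !mxE !eqxx /GRing.scale /= !mulr1.
  rewrite (eq_bigr (fun k => eta k (x ord0 k))); first by rewrite -mulrBl mulrA.
  by move=> k ki; rewrite !mxE eqxx (negPf ki) /= mulr0 add0r.
have cv : (fun h : R => h^-1 *: ((prodf eta \o shift x) (h *: @ebasis R m i) - prodf eta x))
   @ 0^' --> prodf (upd eta i g') x.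
  rewrite E prodf_upd; apply: cvgMl; rewrite -dE; exact: dv.
apply: DeriveDef; first by apply/cvg_ex; eexists; exact: cv.
exact/cvg_lim.
Qed.

(** A partial derivative replaces one factor by its derivative, so products of smooth one-variable
    functions are stable under iterated partial derivatives. *)
Lemma pderivs_prodf eta (s : seq 'I_m) : (forall k, smooth1 (eta k)) ->
  exists eta', (forall k, smooth1 (eta' k)) /\ pderivs s (prodf eta) = prodf eta'.
Proof.
move=> seta; elim: s => [|i s [eta' [seta' E]]]; first by exists eta.
have [g' [dg' sg']] := smooth1_derive (seta' i).
exists (upd eta' i g'); split.
  by move=> k; rewrite /upd; case: ifP.
rewrite /= -/(pderivs s _) E; apply/funext => x; rewrite /pderiv.
exact: (@derive_val _ _ _ _ _ _ _ (is_derive_prodf dg' x)).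
Qed.

Lemma smooth_prodf eta : (forall k, smooth1 (eta k)) -> smooth (prodf eta).
Proof.
move=> seta s; have [eta' [seta' ->]] := pderivs_prodf s seta; split.
  by apply: continuous_prodf => k; exact: smooth1_continuous.
move=> i x; have [g' [dg' _]] := smooth1_derive (seta' i).
by have [] := is_derive_prodf dg' x.
Qed.

Lemma compact_box (a b : 'rV[R]_m) : compact (box a b).
Proof.
rewrite (_ : box a b = [set v | forall i, (`[a ord0 i, b ord0 i]%classic) (v ord0 i)]).
  apply: (@rV_compact R m (fun i => `[a ord0 i, b ord0 i]%classic)) => i.
  exact: segment_compact.
by apply/seteqP; split => x H i /=; have := H i; rewrite /= in_itv.
Qed.

Lemma prodf_out eta (a b : 'rV[R]_m) x : 
  (forall k t, ~~ (a ord0 k < t < b ord0 k) -> eta k t = 0) ->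
  ~ box a b x -> prodf eta x = 0.
Proof.
move=> e0 /existsNP[i /negP xi]; rewrite /prodf (bigD1 i) //= e0 ?mul0r //.
by apply: contra xi => /andP[/ltW -> /ltW ->].
Qed.

Lemma test_fun_prodf (Omega : set 'rV[R]_m) eta (a b : 'rV[R]_m) :
  (forall k, smooth1 (eta k)) ->
  (forall k t, ~~ (a ord0 k < t < b ord0 k) -> eta k t = 0) ->
  box a b `<=` Omega -> test_fun Omega (prodf eta).
Proof.
move=> seta e0 abO; split; first exact: smooth_prodf.
exists (box a b); split => //; first exact: compact_box.
by move=> x; exact: prodf_out.
Qed.

End product_test_functions.

(** * Absolute continuity on lines *)

Section segment_measure.
Context {R : realType}.
Local Open Scope ereal_scope.
Local Notation leb := (@lebesgue_measure R).

(** Restriction of Lebesgue measure, kept as a finite measure on the whole line so that Fubini and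
    almost-everywhere statements apply on [setT]. *)
Definition seg (s : R) : set (measurableTypeR R) -> \bar R :=
  mrestr leb (@measurable_itv R `[0%R, s]).

HB.instance Definition _ (s : R) := Measure.on (seg s).

Lemma segT s : seg s setT = leb `[0%R, s].
Proof. by rewrite /seg /mrestr setTI. Qed.

Let seg_fin s : fin_num_fun (seg s).
Proof.
move=> A mA; rewrite ge0_fin_numE // /seg /mrestr.
apply: (@le_lt_trans _ _ (leb `[0%R, s])).
  apply: le_measure; rewrite ?inE//; apply: measurableI => //.
by rewrite lebesgue_measure_itv /=; case: ifP => _; rewrite ?ltry.
Qed.

HB.instance Definition _ (s : R) := Measure_isFinite.Build _ _ _ (seg s) (seg_fin s).

Lemma segT_lty s : seg s setT < +oo.
Proof. by rewrite -ge0_fin_numE // seg_fin. Qed.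

Lemma segC s : seg s (~` `[0%R, s]) = 0.
Proof. by rewrite /seg /mrestr setICl measure0. Qed.

Lemma segTE s : (0 <= s)%R -> seg s setT = s%:E.
Proof.
move=> s0; rewrite segT lebesgue_measure_itv /= lte_fin.
by case: ltgtP s0 => // [s0 _|<-]; rewrite ?oppr0 ?adde0.
Qed.

Lemma integral_seg s (f : R -> \bar R) : measurable_fun setT f ->
  \int[seg s]_r f r = \int[leb]_(r in `[0%R, s]) f r.
Proof.
move=> mf; pose D : set (measurableTypeR R) := `[0%R, s]%classic.
have mD : measurable D by exact: measurable_itv.
have mDC : measurable (~` D) by exact: measurableC.
have mf' E : measurable_fun (E : set (measurableTypeR R)) f by exact: measurable_funTS.
rewrite -/D -(setUv D) (integral_setU _ mD mDC (mf' _)); last exact/disj_setPCl.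
rewrite [X in _ + X](null_set_integral mDC (mf' _)) ?adde0; last first.
  exact: segC.
apply: eq_measure_integral => A mA AD.
by rewrite /= /seg /mrestr; congr (leb _); exact/setIidPl.
Qed.

Lemma seg_ae s : {ae seg s, forall r, (0 <= r <= s)%R}.
Proof.
exists (~` `[0%R, s]); split.
- exact: measurableC.
- exact: segC.
- by move=> r /= H; rewrite in_itv.
Qed.

Lemma ge0_le_integral_seg s h (f : R -> \bar R) : (s <= h)%R -> measurable_fun setT f ->
  (forall r, 0 <= f r) -> \int[seg s]_r f r <= \int[seg h]_r f r.
Proof.
move=> sh mf f0; rewrite !integral_seg //; apply: ge0_subset_integral => //.
  exact: measurable_funTS.
by move=> r /=; rewrite !in_itv /= => /andP[-> /le_trans]; apply.
Qed.

End segment_measure.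

Section zero_on_boxes.
Context {R : realType} (m : nat).
Local Open Scope ereal_scope.
Implicit Types a b p q : 'rV[R]_m.

(** The Borel sets on whose trace in [box p q] the integral of [h] is 0 form a Dynkin system
    containing the boxes, hence are all Borel sets. *)
Lemma ae_eq0_box p q (h : 'rV[R]_m -> \bar R) : (mu m).-integrable setT h ->
  (forall a b, box a b `<=` box p q -> \int[mu m]_(x in box a b) h x = 0) ->
  ae_eq (mu m) (box p q) h (cst 0).
Proof.
move=> ih h0; have mQ := measurable_box p q.
have ihS A : measurable A -> (mu m).-integrable A h by move=> mA; apply: integrableS ih.
have mh : measurable_fun setT h := measurable_int _ ih.
pose P := [set A : set 'rV[R]_m | \int[mu m]_(x in A `&` box p q) h x = 0].
have HP A : measurable A -> P A.
  move=> mA.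
  apply: (@dynkin_induction _ _ [set A | exists a b, A = box a b] P (measurable_rV_box m)).
  - by move=> _ _ [a [b ->]] [c [d ->]]; rewrite boxI; eexists; eexists.
  - by rewrite /P /= setTI; exact: h0.
  - move=> _ [a [b ->]]; rewrite /P /= boxI; apply: h0; rewrite -boxI; exact: subIsetr.
  - move=> S mS PS; rewrite /P /=.
    have : \int[mu m]_(x in box p q) h x = 0 by exact: h0.
    rewrite -{1}(setIT (box p q)) -(setUv S) setIUr integral_setU //; last 4 first.
    + exact: measurableI.
    + by apply: measurableI => //; exact: measurableC.
    + exact: measurable_funTS.
    + apply/disj_setPS => x [[_ ?] [_ +]]; exact.
    by rewrite (setIC _ S) PS add0e setIC.
  - move=> F mF tF PF; rewrite /P /= setI_bigcupl integral_bigcup //.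
    + by apply: eseries0 => i _ _; exact: PF.
    + exact: trivIset_setIr.
    + by move=> k; exact: measurableI.
    + apply: ihS; apply: bigcupT_measurable => k; exact: measurableI.
  - by rewrite -measurable_rV_box.
apply: integral_ae_eq => //; first exact: ihS.
by move=> E EQ mE; rewrite integral0; have := HP E mE; rewrite /P /= (setIidl EQ).
Qed.

(** The faces of a box are degenerate boxes. The bumps converge to 1 only in the open box, so the
    boundary has to be discarded. *)
Lemma ae_box_interior a b :
  {ae mu m, forall x, box a b x -> forall i, (a ord0 i < x ord0 i < b ord0 i)%R}.
Proof.
suff H i : {ae mu m, forall x, box a b x -> (a ord0 i < x ord0 i < b ord0 i)%R}.
  by apply: filterS (filter_forall (ae_filter_ringOfSetsType (mu m)) H) => x Hx xab i; exact: Hx.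
pose b' : 'rV[R]_m := \row_j (if j == i then a ord0 i else b ord0 j)%R.
pose a' : 'rV[R]_m := \row_j (if j == i then b ord0 i else a ord0 j)%R.
have Z (c d : 'rV[R]_m) : c ord0 i = d ord0 i -> mu m (box c d) = 0.
  by move=> cd; rewrite mu_box /vol (bigD1 i) //= cd subrr maxxx mul0r.
exists (box a b' `|` box a' b); split.
- by apply: measurableU; exact: measurable_box.
- have Z1 : mu m (box a b') = 0 by apply: Z; rewrite mxE eqxx.
  have Z2 : mu m (box a' b) = 0 by apply: Z; rewrite mxE eqxx.
  exact: etrans (measureU0 (measurable_box a b') (measurable_box a' b) Z2) Z1.
- move=> x /not_implyP[xab /negP]; have := xab i => /andP[ax xb].
  rewrite negb_and -!leNgt => /orP[xa|bx]; [left|right] => j; rewrite mxE; case: eqP => [->|_].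
  + by rewrite ax xa.
  + exact: xab.
  + by rewrite bx xb.
  + exact: xab.
Qed.

End zero_on_boxes.

Lemma cvg_prod1 (R : realType) (J : Type) (s : seq J) (u : J -> nat -> R) :
  (forall k, u k n @[n --> \oo] --> (1 : R)) ->
  \prod_(k <- s) u k n @[n --> \oo] --> (1 : R).
Proof.
move=> cu; elim: s => [|k s IH].
  by under eq_fun do rewrite big_nil; exact: cvg_cst.
under eq_fun do rewrite big_cons.
suff : u k n * \prod_(j <- s) u j n @[n --> \oo] --> (1 * 1 : R) by rewrite mulr1.
by apply: cvgM.
Qed.

Section ftc_ae.
Context {R : realType} (m : nat).
Local Open Scope ereal_scope.
Implicit Types (F G : 'rV[R]_m -> R) (p q a b : 'rV[R]_m).

Lemma measurable_line d (X : measurableType d) (u : X -> 'rV[R]_m) (t : X -> R) v :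
  measurable_fun setT u -> measurable_fun setT t ->
  measurable_fun setT (fun x => u x + t x *: v)%R.
Proof.
move=> mu_ mt; apply: measurable_fun_rV => i; under eq_fun do rewrite !mxE.
apply: measurable_funD; first exact: (measurableT_comp (measurable_coord i)).
exact: measurable_funM.
Qed.

(* [G] is the weak [i]-th partial derivative of [F] in [box p q], tested only
   against products of one-variable functions. *)
Definition weakd p q F G (i : 'I_m) := forall eta a b g',
  (forall k, smooth1 (eta k)) ->
  (forall k t, ~~ (a ord0 k < t < b ord0 k)%R -> eta k t = 0%R) ->
  box a b `<=` box p q -> (forall t : R, is_derive t 1%R (eta i) (g' t)) ->
  \int[mu m]_x (F x * prodf (upd eta i g') x)%:E =
  - \int[mu m]_x (G x * prodf eta x)%:E.

Section shifted.
Variables (G : 'rV[R]_m -> R) (v : 'rV[R]_m) (s : R).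
Hypothesis iG : (mu m).-integrable setT (EFin \o G).

Let mG : measurable_fun setT G.
Proof. exact: ((measurable_EFinP _ _).1 (measurable_int _ iG)). Qed.

Lemma measurable_shift_line :
  measurable_fun setT (fun z : 'rV[R]_m * measurableTypeR R => G (z.1 + z.2 *: v)%R).
Proof. exact: (measurableT_comp mG (measurable_line v measurable_fst measurable_snd)). Qed.

(** By Tonelli and translation invariance the integral of the absolute value is the length of the
    segment times the [L^1] norm of [G]. Through Fubini, [G] is then integrable along almost every
    segment in direction [v]. *)
Lemma integrable_shift_line : (mu m \x seg s).-integrable setT
  (fun z : 'rV[R]_m * measurableTypeR R => (G (z.1 + z.2 *: v)%R)%:E).
Proof.
apply/integrable21ltyP.
  exact: ((measurable_EFinP _ _).2 measurable_shift_line).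
under eq_integral => r _.
  rewrite (ge0_integral_shift (r *: v)%R (g := fun x => `|(G x)%:E|)) //; last first.
    by apply: measurableT_comp => //; exact/measurable_EFinP.
  over.
rewrite integral_cst //= lte_mul_pinfty //.
- exact: integral_ge0.
- by have /integrableP[_] := iG; rewrite ge0_fin_numE //; exact: integral_ge0.
- exact: segT_lty.
Qed.

End shifted.

Section main.
Variables (p q : 'rV[R]_m) (F G : 'rV[R]_m -> R) (i : 'I_m) (s : R).
Hypotheses (iF : (mu m).-integrable setT (EFin \o F))
           (iG : (mu m).-integrable setT (EFin \o G))
           (FG : weakd p q F G i) (s0 : (0 < s)%R).
Local Notation e := (@ebasis R m i).

Let I (x : 'rV[R]_m) := \int[seg s]_r (G (x + r *: e)%R)%:E.
Let K (z : 'rV[R]_m * measurableTypeR R) := (G (z.1 + z.2 *: e)%R)%:E.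

Let iK : (mu m \x seg s).-integrable setT K.
Proof. exact: integrable_shift_line. Qed.

Let iI : (mu m).-integrable setT I.
Proof. exact: (integrable_fubini_F iK). Qed.

Let h (x : 'rV[R]_m) := (F (x + s *: e)%R)%:E - (F x)%:E - I x.

Let iFs : (mu m).-integrable setT (fun x => (F (x + s *: e)%R)%:E).
Proof. exact: (integrable_shift (s *: e)%R iF). Qed.

Let ih : (mu m).-integrable setT h.
Proof. by apply: integrableB => //; apply: integrableB. Qed.

Section test.
Variables (eta : 'I_m -> R -> R) (a b : 'rV[R]_m).
Hypotheses (seta : forall k, smooth1 (eta k))
  (eta0 : forall k t, ~~ (a ord0 k < t < b ord0 k)%R -> eta k t = 0%R)
  (eta_itv : forall k t, (0 <= eta k t <= 1)%R)
  (abpq : box a (b + s *: e) `<=` box p q).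

Let phi := prodf eta.

Let mphi : measurable_fun setT phi.
Proof.
by apply: continuous_measurable_rV; apply: continuous_prodf => k; exact: smooth1_continuous.
Qed.

Let phi_itv x : (0 <= phi x <= 1)%R.
Proof.
apply/andP; split; first by apply: prodr_ge0 => k _; case/andP: (eta_itv k (x ord0 k)).
by apply: prodr_ile1 => k _; exact: eta_itv.
Qed.

Let phi_bounded (X : Type) (f : X -> 'rV[R]_m) : [bounded phi (f x) | x in setT].
Proof.
exists 1%R; split => // M M1 x _ /=; have /andP[p0 p1] := phi_itv (f x).
by rewrite ger0_norm //; lra.
Qed.

Let mphis (r : R) : measurable_fun setT (fun x : 'rV[R]_m => phi (x - r *: e)%R).
Proof. exact: (measurableT_comp mphi (measurable_shift _)). Qed.

Let phiE x r : phi (x - r *: e)%R =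
  (eta i (x ord0 i - r) * \prod_(k | k != i) eta k (x ord0 k))%R.
Proof.
rewrite /phi /prodf (bigD1 i) //= !mxE !eqxx mulr1; congr (_ * _)%R.
by apply: eq_bigr => k ki; rewrite !mxE eqxx (negPf ki) /= mulr0 subr0.
Qed.

Let iphiK : (mu m \x seg s).-integrable setT
  (fun z : 'rV[R]_m * measurableTypeR R => (phi z.1)%:E * K z).
Proof.
have mf : measurable_fun setT (fun z : 'rV[R]_m * measurableTypeR R => phi z.1).
  exact: (measurableT_comp mphi measurable_fst).
exact: (integrableMr measurableT mf (phi_bounded fst) iK).
Qed.

(** At fixed [r], translation invariance moves the shift by [r e] from [G] to the test function. *)
Let fubini_phiI : \int[mu m]_x ((phi x)%:E * I x) =
  \int[mu m]_x \int[seg s]_r (G x * phi (x - r *: e))%:E.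
Proof.
transitivity (\int[mu m]_x \int[seg s]_r ((phi x)%:E * K (x, r))).
  apply: ae_eq_integral => //.
  - apply: emeasurable_funM; first exact/measurable_EFinP.
    exact: measurable_int iI.
  - exact: (measurable_fubini_F iphiK).
  - by apply: filterS (ae_integrable1 iK) => x ix _; rewrite integralZl.
rewrite (Fubini iphiK).
have iK1 : (mu m \x seg s).-integrable setT
    (fun z : 'rV[R]_m * measurableTypeR R => (G z.1 * phi (z.1 - z.2 *: e))%:E).
  have iG1 : (mu m \x seg s).-integrable setT (fun z : 'rV[R]_m * measurableTypeR R => (G z.1)%:E).
    apply: eq_integrable (integrable_shift_line 0%R s iG) => // z _ /=.
    by rewrite scaler0 addr0.
  have mf : measurable_fun setT (fun z : 'rV[R]_m * measurableTypeR R => phi (z.1 - z.2 *: e)).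
    apply: (measurableT_comp mphi).
    under eq_fun do rewrite -scalerN.
    exact: measurable_line.
  exact: (integrableMl measurableT iG1 mf (phi_bounded (fun z => z.1 - z.2 *: e)%R)).
rewrite (Fubini iK1); apply: eq_integral => r _.
rewrite -(integral_shift (r *: e)%R (g := fun x => (G x * phi (x - r *: e))%:E)); last first.
  exact: (integrableMl measurableT iG (mphis r) (phi_bounded (fun x => x - r *: e)%R)).
by apply: eq_integral => x _; rewrite /K /= addrK -EFinM mulrC.
Qed.

Lemma integral_test_eq0 : \int[mu m]_x ((phi x)%:E * h x) = 0.
Proof.
have [th [sth dth thE]] := exists_difference_primitive (seta i) s0 (eta0 (k := i)).
have thS t : (th t)%:E = \int[seg s]_r (eta i (t - r))%:E.
  rewrite integral_seg //; apply/measurable_EFinP.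
  apply: (measurableT_comp (f := eta i)); last exact: measurable_funB.
  by apply: continuous_measurable_fun; exact: smooth1_continuous.
have meta t : measurable_fun setT (fun r : measurableTypeR R => eta i (t - r)).
  apply: (measurableT_comp (f := eta i)); last exact: measurable_funB.
  by apply: continuous_measurable_fun; exact: smooth1_continuous.
(* Replacing the [i]-th factor by [th] enlarges the support by [s] in direction [i], hence the
   hypothesis on [box a (b + s *: e)]. *)
pose eta1 := upd eta i th.
have W : \int[mu m]_x (F x * prodf (upd eta1 i (fun t => eta i t - eta i (t - s))%R) x)%:E =
  - \int[mu m]_x (G x * prodf eta1 x)%:E.
  apply: (FG (a := a) (b := (b + s *: e)%R)) => //.
  - by move=> k; rewrite /eta1 /upd; case: ifP.
  - move=> k t; rewrite !mxE eqxx /eta1 /upd; case: eqP => [->|_] /=; last first.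
      by rewrite mulr0 addr0; exact: eta0.
    (* Outside []a i, b i + s[], every [t - r] with [0 <= r <= s] is outside []a i, b i[]. *)
    rewrite mulr1 negb_and -!leNgt => H; apply: EFin_inj.
    rewrite -thE integral0_eq // => r /=; rewrite in_itv /= => /andP[r0 rs].
    congr EFin; apply: eta0; rewrite negb_and -!leNgt; case/orP: H => H; apply/orP; [left|right]; lra.
  - by move=> t; rewrite /eta1 /upd eqxx.
have E1 x : prodf (upd eta1 i (fun t => eta i t - eta i (t - s))%R) x = (phi x - phi (x - s *: e))%R.
  rewrite prodf_upd phiE -[phi x](congr1 phi (subr0 x)) -(scale0r e) phiE subr0 -mulrBl.
  by congr (_ * _)%R; apply: eq_bigr => k ki; rewrite /eta1 /upd (negPf ki).
have E2 x : (G x * prodf eta1 x)%:E = \int[seg s]_r (G x * phi (x - r *: e))%:E.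
  rewrite prodf_upd (mulrC (th _)) mulrA EFinM thS -integralZl //.
    by apply: eq_integral => r _; rewrite phiE -EFinM; congr EFin; ring.
  apply: measurable_bounded_integrable => //; first exact: segT_lty.
  exists 1%R; split => // M M1 r _ /=; have /andP[p0 p1] := eta_itv i (x ord0 i - r).
  by rewrite ger0_norm //; lra.
have i1 : (mu m).-integrable setT (fun x => (F x * phi x)%:E).
  exact: (integrableMl measurableT iF mphi (phi_bounded id)).
have i2 : (mu m).-integrable setT (fun x => (F x * phi (x - s *: e))%:E).
  exact: (integrableMl measurableT iF (mphis s) (phi_bounded (fun x => x - s *: e)%R)).
have i3 : (mu m).-integrable setT (fun x => (F (x + s *: e) * phi x)%:E).
  exact: (integrableMl measurableT iFs mphi (phi_bounded id)).
have i4 : (mu m).-integrable setT (fun x => (phi x)%:E * I x).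
  exact: (integrableMr measurableT mphi (phi_bounded id) iI).
move: W; under eq_integral do rewrite E1 mulrBr EFinB.
rewrite integralB //.
under [in X in _ = - X]eq_integral do rewrite E2.
rewrite -fubini_phiI => W.
transitivity (\int[mu m]_x ((F (x + s *: e) * phi x)%:E - (F x * phi x)%:E - (phi x)%:E * I x)).
  apply: eq_integral => x _; rewrite /h -EFinB muleBr //.
  by rewrite -!EFinM -EFinB mulrBr !(mulrC (phi x)).
rewrite integralB //; last exact: integrableB.
rewrite integralB //.
have -> : \int[mu m]_x (F (x + s *: e) * phi x)%:E = \int[mu m]_x (F x * phi (x - s *: e))%:E.
  rewrite -(integral_shift (s *: e)%R i2).
  by apply: eq_integral => x _; rewrite addrK.
move: W (integrable_fin_num measurableT i1) (integrable_fin_num measurableT i2) (integrable_fin_num measurableT i4).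
case: (\int[mu m]_x (F x * phi x)%:E) => [A||] //.
case: (\int[mu m]_x (F x * phi (x - s *: e))%:E) => [B||] //.
case: (\int[mu m]_x ((phi x)%:E * I x)) => [C||] // [W] _ _ _.
by rewrite -!EFinB; congr EFin; lra.
Qed.

End test.
(* Tested against the function obtained by averaging a product bump over the
   translations by [r e], [0 <= r <= s], the weak equation becomes the claimed identity
   integrated against the bump itself. *)
Lemma ftc_ae : {ae mu m, forall x, box p (q - s *: e) x ->
  (F (x + s *: e) - F x)%:E = \int[seg s]_r (G (x + r *: e)%R)%:E}.
Proof.
have mh : measurable_fun setT h := measurable_int _ ih.
have H0 : ae_eq (mu m) (box p (q - s *: e)) h (cst 0).
  apply: ae_eq0_box => // a b abpq.
  (* A nonempty box contains both its corners, which turns the inclusion of boxes into inequalities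
     between corners. *)
  have [->|/set0P[x0 x0ab]] := eqVneq (box a b) set0; first by rewrite integral_set0.
  have ab k : (a ord0 k <= b ord0 k)%R by have /andP[] := x0ab k; exact: le_trans.
  have abpq' : box a (b + s *: e) `<=` box p q.
    have aP : box a b a by move=> k; rewrite lexx ab.
    have bP : box a b b by move=> k; rewrite lexx ab.
    move=> x xab k; have := xab k; have := abpq _ aP k; have := abpq _ bP k.
    rewrite !mxE; lra.
  pose eta n (k : 'I_m) := bump (a ord0 k) (b ord0 k) n.
  pose phi n := prodf (eta n).
  have phi_itv n x : (0 <= phi n x <= 1)%R.
    apply/andP; split; first by apply: prodr_ge0 => k _; have /andP[] := bump_itv (a ord0 k) (b ord0 k) n (x ord0 k).
    by apply: prodr_ile1 => k _; exact: bump_itv.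
  have seta n k : smooth1 (eta n k) by exact: smooth1_bump.
  have Z n : \int[mu m]_x ((phi n x)%:E * h x) = 0.
    apply: (integral_test_eq0 (a := a) (b := b)) => //.
      by move=> k t; exact: bump_out.
    by move=> k t; exact: bump_itv.
  have mphi n : measurable_fun setT (phi n).
    by apply: continuous_measurable_rV; apply: continuous_prodf => k; exact: smooth1_continuous.
  have mab := measurable_box a b.
  have [] := @dominated_convergence _ _ _ (mu m) setT measurableT
    (fun n x => (phi n x)%:E * h x) (h \_ (box a b)) (fun x => `|h x|).
  - by move=> n; apply: emeasurable_funM => //; exact/measurable_EFinP.
  - by apply/(measurable_restrictT _ mab); exact: measurable_funTS.
  - have fh := integrable_ae measurableT ih.
    apply: filterS2 fh (ae_box_interior a b) => x hfin xab _.
    rewrite patchE; case: ifPn => [/[!inE]/xab xi|].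
      rewrite -(fineK (hfin Logic.I)).
      have : (fun n => phi n x * fine (h x))%R @ \oo --> (1 * fine (h x))%R.
        apply: cvgMl; apply: cvg_prod1 => k; apply: bump_cvg; exact: xi.
      rewrite mul1r => H; under eq_fun do rewrite -EFinM.
      by apply/fine_cvgP; split; [exact: nearW|exact: H].
    rewrite notin_setE => xnab.
    have E n : phi n x = 0%R by apply: prodf_out xnab => k t; exact: bump_out.
    by under eq_fun do rewrite E mul0e; exact: cvg_cst.
  - exact: integrable_abse.
  - apply: aeW => x n _; rewrite abseM /= ger0_norm; last by case/andP: (phi_itv n x).
    by rewrite -[leRHS]mul1e lee_wpmul2r // lee_fin; case/andP: (phi_itv n x).
  move=> _ _; under eq_fun do rewrite Z.
  move=> /(cvg_unique (@ereal_hausdorff R) (cvg_cst 0)).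
  by rewrite -integral_mkcond => <-.
apply: filterS H0 => x + xQ => /(_ xQ).
rewrite /h -EFinB /I; case: (\int[seg s]_r _) => [r||] //= [].
by move=> /eqP; rewrite subr_eq0 => /eqP ->.
Qed.

End main.
End ftc_ae.

(** * Continuity of translations in L^1 *)

Section translation.
Context {R : realType} (m : nat) (v : 'rV[R]_m).
Local Open Scope ereal_scope.
Implicit Types (F G H : 'rV[R]_m -> R) (A : set 'rV[R]_m).
Local Notation T := 'rV[R]_m.

Definition L1dist F G := \int[mu m]_x (`|F x - G x|%R)%:E.

Definition transl t G := fun x : T => G (x + t *: v)%R.

(** Only continuity at [t = 0] along the fixed direction [v] is recorded. The property is extended
    from boxes to larger and larger classes, up to all integrable functions. *)
Definition L1cont G := (mu m).-integrable setT (EFin \o G) /\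
  forall e : R, (0 < e)%R -> exists2 d : R, (0 < d)%R &
    forall t : R, (`|t| <= d)%R -> L1dist (transl t G) G <= e%:E.

Lemma measurable_integrable G : (mu m).-integrable setT (EFin \o G) -> measurable_fun setT G.
Proof. by move=> iG; exact: ((measurable_EFinP _ _).1 (measurable_int _ iG)). Qed.

Lemma integrable_transl t G : (mu m).-integrable setT (EFin \o G) ->
  (mu m).-integrable setT (EFin \o transl t G).
Proof. exact: (integrable_shift (t *: v)%R). Qed.

Lemma measurable_L1 F G : measurable_fun setT F -> measurable_fun setT G ->
  measurable_fun setT (fun x => (`|F x - G x|%R)%:E).
Proof.
by move=> mF mG; apply/measurable_EFinP; apply: measurableT_comp => //; exact: measurable_funB.
Qed.

Lemma L1dist_ge0 F G : 0 <= L1dist F G.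
Proof. by apply: integral_ge0 => x _; rewrite lee_fin. Qed.

Lemma L1dist_triangle F G H : measurable_fun setT F -> measurable_fun setT G ->
  measurable_fun setT H -> L1dist F H <= L1dist F G + L1dist G H.
Proof.
move=> mF mG mH; rewrite /L1dist -ge0_integralD //; last 2 first.
- exact: measurable_L1.
- exact: measurable_L1.
apply: ge0_le_integral => //.
- exact: measurable_L1.
- by apply: emeasurable_funD; exact: measurable_L1.
- by move=> x _; rewrite -EFinD lee_fin ler_distD.
Qed.

Lemma L1distC F G : L1dist F G = L1dist G F.
Proof. by apply: eq_integral => x _; rewrite distrC. Qed.

Lemma L1dist_transl t F G : measurable_fun setT F -> measurable_fun setT G ->
  L1dist (transl t F) (transl t G) = L1dist F G.
Proof.
move=> mF mG.
apply: (ge0_integral_shift (t *: v)%R (g := fun x => (`|F x - G x|%R)%:E)) => //.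
exact: measurable_L1.
Qed.

Lemma L1contD F G : L1cont F -> L1cont G -> L1cont (F \+ G)%R.
Proof.
move=> [iF cF] [iG cG]; split.
  by rewrite (_ : EFin \o _ = (EFin \o F) \+ (EFin \o G)) //; exact: integrableD.
move=> e e0; have e20 : (0 < e / 2)%R by rewrite divr_gt0.
have [d d0 Hd] := cF _ e20; have [d' d'0 Hd'] := cG _ e20.
exists (Num.min d d'); first by rewrite lt_min d0.
move=> t; rewrite le_min => /andP[td td'].
have mF := measurable_integrable iF; have mG := measurable_integrable iG.
have mFt := measurable_integrable (integrable_transl t iF).
have mGt := measurable_integrable (integrable_transl t iG).
rewrite (splitr e) EFinD; apply: le_trans (leeD (Hd t td) (Hd' t td')).
rewrite /L1dist -ge0_integralD //; [|exact: measurable_L1..].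
apply: ge0_le_integral => //.
- by apply: measurable_L1; [exact: measurable_funD|exact: measurable_funD].
- by apply: emeasurable_funD; exact: measurable_L1.
- move=> x _; rewrite -EFinD lee_fin /transl /=.
  by rewrite opprD addrACA ler_normD.
Qed.

Lemma L1contZ c G : L1cont G -> L1cont (fun x => c * G x)%R.
Proof.
move=> [iG cG]; split; first exact: (integrableZl measurableT c iG).
move=> e e0; have e1 : (0 < e / (`|c| + 1))%R by rewrite divr_gt0 // ltr_wpDl.
have [d d0 Hd] := cG _ e1; exists d => // t td.
have mG := measurable_integrable iG.
have mGt := measurable_integrable (integrable_transl t iG).
apply: (@le_trans _ _ ((`|c|)%:E * L1dist (transl t G) G)).
  rewrite /L1dist -ge0_integralZl //; last exact: measurable_L1.
  apply: ge0_le_integral => //.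
  - by apply: measurable_L1; exact: measurable_funM.
  - by apply: emeasurable_funM => //; exact: measurable_L1.
  - by move=> x _; rewrite -EFinM lee_fin /transl -mulrBr normrM.
apply: le_trans (lee_wpmul2l _ (Hd t td)) _; first by rewrite lee_fin.
rewrite -EFinM lee_fin mulrA ler_pdivrMr ?ltr_wpDl // mulrC ler_wpM2l //; first exact: ltW.
by rewrite lerDl.
Qed.

(** Translations are isometries of [L^1], so the distance to the approximant is paid twice and its
    own modulus of continuity once. *)
Lemma L1cont_lim G : (mu m).-integrable setT (EFin \o G) ->
  (forall e : R, (0 < e)%R -> exists2 H, L1cont H & L1dist H G <= e%:E) -> L1cont G.
Proof.
move=> iG HG; split => // e e0; have e30 : (0 < e / 3)%R by rewrite divr_gt0.
have [H [iH cH] HGe] := HG _ e30; have [d d0 Hd] := cH _ e30.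
exists d => // t td.
have mG := measurable_integrable iG; have mH := measurable_integrable iH.
have mGt := measurable_integrable (integrable_transl t iG).
have mHt := measurable_integrable (integrable_transl t iH).
apply: le_trans (L1dist_triangle mGt mHt mG) _.
apply: le_trans (leeD (lexx _) (L1dist_triangle mHt mH mG)) _.
rewrite L1dist_transl // L1distC.
apply: le_trans (leeD HGe (leeD (Hd t td) HGe)) _.
by rewrite -!EFinD lee_fin; lra.
Qed.

Lemma integrable_indic_box (a b : T) :
  (mu m).-integrable setT (EFin \o (\1_(box a b) : T -> R)).
Proof.
apply/integrableP; split.
  by apply/measurable_EFinP; apply: measurable_indic; exact: measurable_box.
under eq_integral do rewrite /= ger0_norm //.
by rewrite integral_indic ?setIT //; [exact: mu_box_lty|exact: measurable_box].
Qed.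

Lemma cvg_prod_seq (J : Type) (s : seq J) (u : J -> R -> R) (l : J -> R) (x : R) :
  (forall k, u k t @[t --> x] --> l k) ->
  (\prod_(k <- s) u k t)%R @[t --> x] --> (\prod_(k <- s) l k)%R.
Proof.
move=> cu; elim: s => [|k s IH].
  by under eq_fun do rewrite big_nil; rewrite big_nil; exact: cvg_cst.
under eq_fun do rewrite big_cons; rewrite big_cons.
by apply: cvgM.
Qed.

(** A box and its translate meet in a box whose sides are shortened by [|t * v k|]. The distance of
    the indicators is twice the volume lost, a continuous function of [t]. *)
Lemma L1cont_box (a b : T) : L1cont (\1_(box a b)).
Proof.
split; first exact: integrable_indic_box.
have mB := measurable_box a b.
pose W (t : R) := (\prod_k Num.max 0 (b ord0 k - a ord0 k - `|t * v ord0 k|))%R.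
have WE t : L1dist (transl t \1_(box a b)) \1_(box a b) = (2 * (vol a b - W t))%:E.
  pose c : T := \row_k Num.max (a ord0 k) (a ord0 k - t * v ord0 k)%R.
  pose d : T := \row_k Num.min (b ord0 k) (b ord0 k - t * v ord0 k)%R.
  pose a' := (a - t *: v)%R; pose b' := (b - t *: v)%R.
  have tE : transl t \1_(box a b) = \1_(box a' b').
    apply/funext => x; rewrite /transl !indicE; congr (nat_of_bool _)%:R.
    apply/idP/idP; rewrite !inE => H k; have := H k; rewrite !mxE; lra.
  have Icd : box a b `&` box a' b' = box c d.
    by rewrite boxI; congr box; apply/rowP => k; rewrite !mxE.
  have vcd : vol c d = W t.
    apply: eq_bigr => k _; rewrite !mxE; congr Num.max.
    move: (a ord0 k) (b ord0 k) (t * v ord0 k)%R => p q r.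
    have [r0|r0] := leP 0%R r.
      by rewrite (ger0_norm r0) max_l ?min_r; lra.
    by rewrite (ltr0_norm r0) max_r ?min_l; lra.
  have vab' : vol a' b' = vol a b.
    by apply: eq_bigr => k _; rewrite !mxE; congr Num.max; lra.
  rewrite tE.
  (* Adding twice the indicator of the overlap avoids integrating over a symmetric difference, which
     is not a box. *)
  have E x : (`|\1_(box a' b') x - \1_(box a b) x|%R)%:E + (2 * \1_(box c d) x)%:E =
      (\1_(box a' b') x)%:E + (\1_(box a b) x)%:E :> \bar R.
    rewrite -!EFinD; congr EFin; rewrite -Icd !indicE in_setI.
    case: (x \in box a b); case: (x \in box a' b') => /=;
      rewrite ?subrr ?subr0 ?sub0r ?normrN ?normr0 ?normr1; ring.
  have mI p q : measurable_fun setT (\1_(box p q) : T -> R).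
    by apply: measurable_indic; exact: measurable_box.
  have IB p q : \int[mu m]_x (\1_(box p q) x)%:E = (vol p q)%:E.
    by rewrite (integral_indic _ measurableT (measurable_box p q)) setIT; exact: mu_box.
  have S : L1dist \1_(box a' b') \1_(box a b) + (2 * W t)%:E = (vol a b + vol a b)%:E.
    have -> : (2 * W t)%:E = \int[mu m]_x (2 * \1_(box c d) x)%:E.
      under eq_integral do rewrite EFinM.
      rewrite ge0_integralZl //; last exact/measurable_EFinP.
      by rewrite IB vcd.
    rewrite /L1dist -ge0_integralD //; last 2 first.
    - exact: measurable_L1.
    - by apply/measurable_EFinP; exact: measurable_funM.
    under eq_integral do rewrite E.
    rewrite ge0_integralD //; [|exact/measurable_EFinP..].
    by rewrite !IB vab' EFinD.
  move: S; case: (L1dist _ _) => [r| |] //= [S]; congr EFin; lra.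
have cW : W t @[t --> (0 : R)%R] --> vol a b.
  apply: cvg_prod_seq => k.
  have H : {for (0 : R)%R, continuous ((cst 0 : R -> R^o) \max (fun t => b ord0 k - a ord0 k - `|t * v ord0 k|))%R}.
    apply: continuous_max; first exact: cst_continuous.
    apply: continuousB; first exact: cst_continuous.
    apply: (@continuous_comp _ _ _ (fun t : R => t * v ord0 k)%R Num.norm).
      by apply: continuousM; [exact: id|exact: cst_continuous].
    exact: norm_continuous.
  have E : (Num.max 0 (b ord0 k - a ord0 k) =
      Num.max 0 (b ord0 k - a ord0 k - `|0 * v ord0 k|))%R by rewrite mul0r normr0 subr0.
  by rewrite E; exact: H.
move=> e e0; have e20 : (0 < e / 2)%R by rewrite divr_gt0.
have /cvgr_dist_lt/(_ _ e20) := cW.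
rewrite -filter_from_ballE => -[d /= d0 Hd].
exists (d / 2)%R; first by rewrite divr_gt0.
move=> t td; rewrite WE lee_fin.
have : (`|vol a b - W t| < e / 2)%R.
  by apply: (Hd t); rewrite /ball /= sub0r normrN; lra.
by move=> /(le_lt_trans (ler_norm _)); lra.
Qed.

Lemma integrable_indic_fin A : measurable A -> mu m A < +oo ->
  (mu m).-integrable setT (EFin \o (\1_A : T -> R)).
Proof.
move=> mA Afin; apply/integrableP; split.
  by apply/measurable_EFinP; exact: measurable_indic.
under eq_integral do rewrite /= ger0_norm //.
by rewrite (integral_indic _ measurableT mA) setIT.
Qed.

(** Intersecting with a fixed box keeps all measures finite. Complements become differences of
    indicators and disjoint unions become [L^1] limits, so a Dynkin argument starts from boxes. *)
Lemma L1cont_indic p q A : measurable A -> L1cont \1_(A `&` box p q).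
Proof.
have mQ := measurable_box p q.
have finQ B : measurable B -> mu m (B `&` box p q) < +oo.
  move=> mB; apply: le_lt_trans (mu_box_lty p q).
  by apply: le_measure; rewrite ?inE //; exact: measurableI.
move=> mA.
pose P := [set A : set T | L1cont \1_(A `&` box p q)].
apply: (@dynkin_induction _ _ [set A | exists a b, A = box a b] P (measurable_rV_box m)).
- by move=> _ _ [a [b ->]] [c [d ->]]; rewrite boxI; eexists; eexists.
- by rewrite /P /= setTI; exact: L1cont_box.
- by move=> _ [a [b ->]]; rewrite /P /= boxI; exact: L1cont_box.
- move=> S mS PS; rewrite /P /=.
  rewrite (_ : \1_(~` S `&` box p q) =
      (\1_(box p q) \+ (fun x => -1 * \1_(S `&` box p q) x))%R).
    by apply: L1contD; [exact: L1cont_box|exact: L1contZ].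
  apply/funext => x /=; rewrite !indicE !in_setI in_setC.
  by case: (x \in S); case: (x \in box p q) => /=; rewrite ?mulr1 ?mulr0; ring.
- move=> F mF tF PF; rewrite /P /=.
  have mU : measurable (\bigcup_k F k) by exact: bigcupT_measurable.
  have iU : (mu m).-integrable setT (EFin \o (\1_(\bigcup_k F k `&` box p q) : T -> R)).
    by apply: integrable_indic_fin; [exact: measurableI|exact: finQ].
  pose S n : T -> R := fun x => (\sum_(k < n) \1_(F k `&` box p q) x)%R.
  have cS n : L1cont (S n).
    elim: n => [|n IH].
      rewrite (_ : S 0%N = (fun x => 0 * \1_(box p q) x)%R); first by apply: L1contZ; exact: L1cont_box.
      by apply/funext => x; rewrite /S big_ord0 mul0r.
    rewrite (_ : S n.+1 = (S n \+ \1_(F n `&` box p q))%R); first by apply: L1contD => //; exact: PF.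
    by apply/funext => x; rewrite /S big_ord_recr.
  have SE n x : S n x = \1_(\big[setU/set0]_(k < n) F k `&` box p q) x.
    elim: n => [|n IH].
      by rewrite /S !big_ord0 set0I indicE in_set0.
    rewrite /S !big_ord_recr /= -/(S n x) IH !indicE !in_setI in_setU.
    case xn : (x \in F n); last by rewrite orbF /= addr0.
    have -> : x \in \big[setU/set0]_(k < n) F k = false.
      apply/negP; rewrite inE -bigcup_mkord => -[k /= kn Fkx].
      move/trivIsetP : tF => /(_ k n Logic.I Logic.I); rewrite (ltn_eqF kn) => /(_ isT).
      by move/seteqP => [/(_ x) + _]; apply; split => //; exact/set_mem.
    by rewrite /= add0r.
  apply: L1cont_lim => // e e0.
  have [] := @dominated_convergence _ _ _ (mu m) setT measurableT
    (fun n x => (S n x)%:E) (EFin \o \1_(\bigcup_k F k `&` box p q)) (EFin \o \1_(box p q)).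
  + by move=> n; apply/measurable_EFinP; exact: measurable_integrable (cS n).1.
  + exact: measurable_int iU.
  + apply: aeW => x _; apply: cvg_near_cst.
    have [[k _ Fkx]|nx] := pselect ((\bigcup_k F k) x).
      near=> n; rewrite SE /=; congr EFin; rewrite !indicE !in_setI; congr (nat_of_bool (_ && _))%:R.
      rewrite (mem_set (_ : (\bigcup_k F k) x)); last by exists k.
      by apply: mem_set; rewrite -bigcup_mkord; exists k => //=; near: n; exists k.+1.
    near=> n; rewrite SE /=; congr EFin; rewrite !indicE !in_setI; congr (nat_of_bool (_ && _))%:R.
    rewrite (memNset nx); apply: memNset => H; apply: nx.
    by move: H; rewrite -bigcup_mkord => -[k _ Fk]; exists k.
  + exact: integrable_indic_box.
  + apply: aeW => x n _ /=; rewrite lee_fin SE ger0_norm // !indicE in_setI.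
    by case: (x \in box p q); rewrite ?andbF ?andbT // ler_nat leq_b1.
  move=> _ /fine_cvgP[_ /cvgrPdist_lt/(_ _ e0)[N _ HN]] _.
  exists (S N) => //; have := HN N (leqnn N).
  rewrite /= sub0r normrN => HNe.
  have fin : L1dist (S N) \1_(\bigcup_k F k `&` box p q) \is a fin_num.
    rewrite ge0_fin_numE ?L1dist_ge0 //.
    have := integrableB measurableT (cS N).1 iU.
    by move=> /integrableP[_].
  rewrite -(fineK fin) lee_fin; apply: ltW.
  by apply: le_lt_trans HNe; exact: ler_norm.
- by rewrite -measurable_rV_box.
Unshelve. all: by end_near. Qed.

Import HBSimple.

Lemma L1cont_sfun p q (g : {sfun T >-> R}) : L1cont (fun x => g x * \1_(box p q) x)%R.
Proof.
have E : (fun x => g x * \1_(box p q) x)%R = (fun x =>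
    \sum_(y <- finmap.enum_fset (fset_set (range g))) y * \1_(g @^-1` [set y] `&` box p q) x)%R.
  apply/funext => x; rewrite {1}fimfunE fsbig_finite //= mulr_suml.
  by apply: eq_bigr => y _; rewrite indicI /= mulrA.
rewrite E; elim: (finmap.enum_fset _) => [|y s IH].
  rewrite (_ : (fun x => _) = (fun x => 0 * \1_(box p q) x)%R); first by apply: L1contZ; exact: L1cont_box.
  by apply/funext => x; rewrite big_nil mul0r.
rewrite (_ : (fun x => _) = ((fun x => y * \1_(g @^-1` [set y] `&` box p q) x) \+
  (fun x => \sum_(y <- s) y * \1_(g @^-1` [set y] `&` box p q) x))%R); last first.
  by apply/funext => x; rewrite big_cons.
by apply: L1contD => //; apply: L1contZ; exact: L1cont_indic.
Qed.

Lemma L1cont_approx G : (mu m).-integrable setT (EFin \o G) ->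
  (exists2 H : nat -> T -> R, forall n, L1cont (H n) &
    (fun n => L1dist (H n) G) @ \oo --> 0) -> L1cont G.
Proof.
move=> iG [H cH HG]; apply: L1cont_lim => // e e0.
move: HG => /fine_cvgP[fin /cvgrPdist_lt/(_ _ e0) HN].
near \oo => n; exists (H n) => //.
have fn : L1dist (H n) G \is a fin_num by near: n.
rewrite -(fineK fn) lee_fin; apply: ltW.
apply: le_lt_trans (ler_norm _) _; rewrite -normrN -sub0r; near: n; exact: HN.
Unshelve. all: by end_near. Qed.

(** Two limits are taken: simple functions approximate [G] on each box [Q n], and the truncations to
    [Q n] tend to [G] by dominated convergence. *)
Lemma L1cont_integrable G : (mu m).-integrable setT (EFin \o G) -> L1cont G.
Proof.
move=> iG; have mG := measurable_integrable iG.
pose Q (n : nat) : set T := box (const_mx (- n%:R)%R) (const_mx n%:R).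
have mQ n : measurable (Q n) by exact: measurable_box.
have iGQ n : (mu m).-integrable setT (EFin \o (fun x => G x * \1_(Q n) x)%R).
  apply: (integrableMl measurableT iG (measurable_indic (mQ n))).
  by exists 1%R; split => // M M1 x _ /=; rewrite ger0_norm // indicE; case: (_ \in _); rewrite /=; lra.
apply: L1cont_approx => //; exists (fun n x => G x * \1_(Q n) x)%R.
  move=> n.
  apply: L1cont_approx => //.
  have [g [ig _ gG]] := approximation_sfun_integrable (mQ n) (integrableS measurableT (mQ n) (@subsetT _ _) iG).
  exists (fun k x => g k x * \1_(Q n) x)%R; first by move=> k; exact: L1cont_sfun.
  apply: cvg_trans gG; apply: near_eq_cvg; apply: nearW => k.
  rewrite integral_mkcond; apply: eq_integral => x _; rewrite epatch_indic /= -mulrBl normrM.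
  by rewrite (ger0_norm (x := \1_(Q n) x)) // distrC.
have [] := @dominated_convergence _ _ _ (mu m) setT measurableT
    (fun n x => (G x * \1_(Q n) x)%:E) (EFin \o G) (fun x => `|(G x)%:E|).
- by move=> n; exact: measurable_int (iGQ n).
- exact: measurable_int iG.
- apply: aeW => x _; apply: cvg_near_cst.
  have [N _ xN] : (\bigcup_n Q n) x by rewrite bigcup_box_const.
  near=> n; rewrite indicE mem_set /= ?mulr1 // => k.
  have Nn : (N <= n)%N by near: n; exists N.
  have : (N%:R <= n%:R :> R)%R by rewrite ler_nat.
  by have := xN k; rewrite !mxE; lra.
- exact: integrable_abse.
- apply: aeW => x n _ /=; rewrite lee_fin normrM ler_piMr //.
  by rewrite ger0_norm // indicE; case: (_ \in _).
by move=> _ + _; exact.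
Unshelve. all: by end_near. Qed.

End translation.

(** * Null sets and almost every line *)

Section ae_lemmas.
Context d (X : measurableType d) (R : realType) (m : {measure set X -> \bar R}).

Lemma ae_imp (P Q : X -> Prop) : (forall x, P x -> Q x) ->
  {ae m, forall x, P x} -> {ae m, forall x, Q x}.
Proof. by move=> PQ [A [mA A0 PA]]; exists A; split => // x nQ; apply: PA => /PQ. Qed.

Lemma ae_imp2 (P Q S : X -> Prop) : (forall x, P x -> Q x -> S x) ->
  {ae m, forall x, P x} -> {ae m, forall x, Q x} -> {ae m, forall x, S x}.
Proof.
move=> PQS [A [mA A0 PA]] [B [mB B0 QB]]; exists (A `|` B); split.
- exact: measurableU.
- exact: etrans (measureU0 mA mB B0) A0.
- move=> x /= nS; have [Px|nP] := pselect (P x); last by left; exact: PA.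
  by right; apply: QB => Qx; exact: nS (PQS _ Px Qx).
Qed.

Lemma ae_forall (J : finType) (P : J -> X -> Prop) :
  (forall j, {ae m, forall x, P j x}) -> {ae m, forall x, forall j, P j x}.
Proof. exact: (filter_forall (ae_filter_ringOfSetsType m)). Qed.

End ae_lemmas.

Section ae_flip.
Local Open Scope ereal_scope.
Context d1 d2 (X : measurableType d1) (Y : measurableType d2) (R : realType).
Variables (m1 : {sigma_finite_measure set X -> \bar R})
          (m2 : {sigma_finite_measure set Y -> \bar R}).

(** By Tonelli both iterated integrals of section measures are the product measure of [A], here 0.
    This exchanges the quantifiers over [x] and [y]. *)
Lemma ae_flip (A : set (X * Y)) : measurable A ->
  {ae m2, forall y, m1 (ysection A y) = 0} ->
  {ae m1, forall x, {ae m2, forall y, ~ A (x, y)}}.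
Proof.
move=> mA A0.
have E : \int[m1]_x m2 (xsection A x) = 0.
  transitivity (\int[m2]_y m1 (ysection A y)).
    have := @indic_fubini_tonelli _ _ _ _ _ m1 m2 A mA.
    by rewrite indic_fubini_tonelli_FE // indic_fubini_tonelli_GE.
  rewrite (@ae_eq_integral _ _ _ m2 setT (cst 0)) ?integral0 //.
    exact: measurable_fun_ysection.
  by apply: filterS A0 => y ->.
have : ae_eq m1 setT (m2 \o xsection A) (cst 0).
  apply/ae_eq_integral_abs => //; first exact: measurable_fun_xsection.
  by under eq_integral do rewrite gee0_abs //.
apply: filterS => x /(_ Logic.I) /= Ax0; exists (xsection A x); split => //.
  exact: measurable_xsection.
by move=> y /= /contrapT Axy; rewrite /xsection /= mem_set.
Qed.

End ae_flip.

Section lines.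
Context {R : realType} (m : nat).
Local Open Scope ereal_scope.
Implicit Types (F G : 'rV[R]_m -> R) (p q : 'rV[R]_m).
Local Notation leb := (@lebesgue_measure R).

(** For each [r] the bad points form a translate of a null set; [ae_flip] then makes almost every
    segment meet the null set in length 0. *)
Lemma ae_line (h : R) (v : 'rV[R]_m) (P : 'rV[R]_m -> Prop) :
  {ae mu m, forall x, P x} ->
  {ae mu m, forall x, {ae seg h, forall r, P (x + r *: v)%R}}.
Proof.
move=> [A [mA A0 PA]].
pose B : set ('rV[R]_m * measurableTypeR R) := (fun z => z.1 + z.2 *: v)%R @^-1` A.
have mB : measurable B.
  rewrite -[B]setTI; apply: (measurable_line v measurable_fst measurable_snd) => //.
have := @ae_flip _ _ _ _ _ (mu m) (seg h) B mB; case.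
  apply: aeW => r.
  rewrite (_ : ysection B r = (fun x => x + r *: v)%R @^-1` A).
    by rewrite mu_shift.
  by apply/seteqP; split => x; rewrite /ysection /= ?inE //; rewrite inE.
move=> C [mC C0 CP]; exists C; split => // x nx; apply: CP => /= H; apply: nx.
by apply: ae_imp H => r; apply: contra_notP => nP; exact: PA.
Qed.

(** The measure [seg z.2] varies with the parameter. The indicator of [0 <= t <= r] moves this
    dependence into the integrand, over a fixed measure. *)
Lemma measurable_integral_seg G v : measurable_fun setT G ->
  measurable_fun setT (fun z : 'rV[R]_m * measurableTypeR R =>
    \int[seg z.2]_t (G (z.1 + t *: v)%R)%:E).
Proof.
move=> mG.
pose S : set (('rV[R]_m * measurableTypeR R) * measurableTypeR R) :=
  [set z | (0 <= z.2)%R] `&` [set z | (z.2 <= z.1.2)%R].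
have mS : measurable S.
  apply: measurableI; rewrite -[X in measurable X]setTI.
    apply: (@measurable_fun_le _ _ _ setT (cst 0%R) (fun z : ('rV[R]_m * measurableTypeR R) * measurableTypeR R => z.2)) => //.
    exact: measurable_snd.
  apply: (@measurable_fun_le _ _ _ setT (fun z : ('rV[R]_m * measurableTypeR R) * measurableTypeR R => z.2) (fun z => z.1.2)) => //; first exact: measurable_snd.
  exact: (measurableT_comp measurable_snd measurable_fst).
pose K (z : ('rV[R]_m * measurableTypeR R) * measurableTypeR R) :=
  (G (z.1.1 + z.2 *: v)%R * \1_S z)%:E.
have mK : measurable_fun setT K.
  apply/measurable_EFinP; apply: measurable_funM; last exact: measurable_indic.
  apply: (measurableT_comp mG); apply: measurable_line => //.
  exact: (measurableT_comp measurable_fst measurable_fst).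
rewrite (_ : (fun z => _) = (fun z => fubini_F leb (K^\+) z - fubini_F leb (K^\-) z)).
  apply: emeasurable_funB; apply: measurable_fun_fubini_tonelli_F => //.
    exact: measurable_funepos.
  exact: measurable_funeneg.
apply/funext => -[x r] /=; rewrite integral_seg; last first.
  by apply/measurable_EFinP; apply: (measurableT_comp mG); exact: measurable_line.
rewrite integral_mkcond [LHS]integralE /fubini_F.
have E t : ((fun t : R => (G (x + t *: v)%R)%:E) \_ `[0%R, r]) t = K (x, r, t).
  rewrite epatch_indic /= /K -EFinM; congr EFin; congr (_ * _)%R.
  rewrite !indicE; congr (nat_of_bool _)%:R; apply/idP/idP; rewrite !inE /= in_itv /S /=.
    by move=> /andP[].
  by move=> [-> ->].
by congr (_ - _); apply: eq_integral => t _; rewrite ?funeposE ?funenegE E.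
Qed.

(** In [ftc_ae] the null set depends on the length. Joint measurability in [(x, r)] and [ae_flip]
    give, for almost every [x], the identity at almost every intermediate point, as required inside
    an integral over [r]. *)
Lemma ftc_ae_line p q F G i h : (mu m).-integrable setT (EFin \o F) ->
  (mu m).-integrable setT (EFin \o G) -> weakd p q F G i ->
  {ae mu m, forall x, {ae seg h, forall r, box p (q - h *: ebasis R i) x ->
    (F (x + r *: ebasis R i) - F x)%:E = \int[seg r]_t (G (x + t *: ebasis R i)%R)%:E}}.
Proof.
move=> iF iG FG; set e := ebasis R i.
have mF := measurable_integrable iF; have mG := measurable_integrable iG.
pose f (z : 'rV[R]_m * measurableTypeR R) := (F (z.1 + z.2 *: e) - F z.1)%:E.
pose g (z : 'rV[R]_m * measurableTypeR R) := \int[seg z.2]_t (G (z.1 + t *: e)%R)%:E.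
have mf : measurable_fun setT f.
  apply/measurable_EFinP; apply: measurable_funB.
    exact: (measurableT_comp mF (measurable_line e measurable_fst measurable_snd)).
  exact: (measurableT_comp mF measurable_fst).
have mg : measurable_fun setT g by exact: measurable_integral_seg.
pose Q := box p (q - h *: e).
pose B := [set z | f z != g z] `&` (fst @^-1` Q).
have mB : measurable B.
  apply: measurableI; rewrite -[X in measurable X]setTI.
    exact: measurable_neqe.
  by apply: measurable_fst => //; exact: measurable_box.
have := @ae_flip _ _ _ _ _ (mu m) (seg h) B mB; case.
  apply: ae_imp (seg_ae h) => r /andP[r0 rh].
  (* Length 0 is not covered by [ftc_ae]; both sides vanish there. *)
  have [r00|rn0] := eqVneq r 0%R.
    rewrite (_ : ysection B r = set0) ?measure0 //; apply/seteqP; split => // x.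
    rewrite /ysection /= inE /B /f /g /= r00 scale0r addr0 subrr => -[+ _].
    rewrite integral_seg ?set_itv1 ?integral_set1 ?eqxx //.
    by apply/measurable_EFinP; apply: (measurableT_comp mG); exact: measurable_line.
  have r1 : (0 < r)%R by rewrite lt_neqAle eq_sym rn0.
  have [C [mC C0 CP]] := ftc_ae iF iG FG r1.
  apply/eqP; rewrite eq_le measure_ge0 andbT -C0.
  apply: le_measure; rewrite ?inE //; first exact: measurable_ysection.
  move=> x; rewrite /ysection /= inE /B /= => -[/eqP nfg xQ]; apply: CP => /= H; apply: nfg.
  apply: H => k; have := xQ k; rewrite !mxE eqxx /=.
  by case: (k == i) => /=; lra.
move=> C [mC C0 CP]; exists C; split => // x nx; apply: CP => /= H; apply: nx.
apply: ae_imp H => r nB xQ; apply/eqP; apply: contra_notT nB => fg.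
by split.
Qed.

End lines.

(** * Increments along one side *)

Section side.
Context {R : realType} (h : R).
Hypothesis h0 : (0 < h)%R.
Local Open Scope ereal_scope.

Lemma integrable_seg_le r (g : R -> R) : (r <= h)%R ->
  (seg h).-integrable setT (EFin \o g) -> (seg r).-integrable setT (EFin \o g).
Proof.
move=> rh /integrableP[mg ig]; apply/integrableP; split => //.
by apply: le_lt_trans ig; apply: ge0_le_integral_seg => //; exact: measurableT_comp.
Qed.

Lemma integrable_seg_cst r (c : R) : (seg r).-integrable setT (EFin \o cst c).
Proof. by apply: finite_measure_integrable_cst. Qed.

Lemma seg_deviation (g : R -> R) (r a c X : R) :
  (seg h).-integrable setT (EFin \o g) -> (0 <= r <= h)%R ->
  X%:E = \int[seg r]_t (g t)%:E ->
  \int[seg h]_t (`|g t - a|%R)%:E <= c%:E -> (`|X - r * a| <= c)%R.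
Proof.
move=> ig /andP[r0 rh] XE gc; have igr := integrable_seg_le rh ig.
have mg : measurable_fun setT (fun t => (g t - a)%R).
  by apply: measurable_funB => //; exact: ((measurable_EFinP _ _).1 (measurable_int _ ig)).
have E : (X - r * a)%:E = \int[seg r]_t (g t - a)%:E.
  under eq_integral do rewrite EFinB.
  rewrite integralB //; last exact: integrable_seg_cst.
  by rewrite -XE integral_cst //= segTE // -EFinM -EFinB (mulrC a).
rewrite -lee_fin -abse_EFin E; apply: le_trans gc.
apply: le_trans (le_abse_integral _ _ _) _ => //; first exact/measurable_EFinP.
by apply: ge0_le_integral_seg => //; apply/measurable_EFinP; exact: measurableT_comp.
Qed.

(** Freezing [U] and [V] at their starting values integrates exactly to [U 0 * V h - V 0 * U h]. The
    rest pairs increments with derivatives; its leading part cancels by antisymmetry, so the error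
    is of order [h^2 d] and not merely [h^2]. Intermediate identities hold only for almost every
    [r], so those at the endpoint [h] are separate hypotheses. *)
Lemma side_estimate n (U V gU gV : 'I_n -> R -> R) (Z gZ : R -> R) (a b : 'I_n -> R) (d : R) :
  (forall k, (seg h).-integrable setT (EFin \o gU k)) ->
  (forall k, (seg h).-integrable setT (EFin \o gV k)) ->
  (seg h).-integrable setT (EFin \o gZ) ->
  {ae seg h, forall r, [/\
    forall k, (U k r - U k 0%R)%:E = \int[seg r]_t (gU k t)%:E,
    forall k, (V k r - V k 0%R)%:E = \int[seg r]_t (gV k t)%:E &
    gZ r = (\sum_(k < n) (U k r * gV k r - V k r * gU k r))%R]} ->
  (forall k, (U k h - U k 0%R)%:E = \int[seg h]_t (gU k t)%:E) ->
  (forall k, (V k h - V k 0%R)%:E = \int[seg h]_t (gV k t)%:E) ->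
  (Z h - Z 0%R)%:E = \int[seg h]_t (gZ t)%:E ->
  (0 <= d)%R ->
  (forall k, \int[seg h]_t (`|gU k t - a k|%R)%:E <= (h * d)%:E) ->
  (forall k, \int[seg h]_t (`|gV k t - b k|%R)%:E <= (h * d)%:E) ->
  (`|Z h - Z 0 - \sum_(k < n) (U k 0 * V k h - V k 0 * U k h)| <=
   \sum_(k < n) 2 * h * h * d * (`|a k| + `|b k| + d))%R.
Proof.
move=> iU iV iZ Hae HUh HVh HZh d0 dU dV.
have meas g : (seg h).-integrable setT (EFin \o g) -> measurable_fun setT g.
  by move=> ig; exact: ((measurable_EFinP _ _).1 (measurable_int _ ig)).
pose w r := (gZ r - \sum_(k < n) (U k 0 * gV k r - V k 0 * gU k r))%R.
have iZl (c : R) g : (seg h).-integrable setT (EFin \o g) ->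
    (seg h).-integrable setT (fun r => c%:E * (g r)%:E).
  by move=> ig; exact: (integrableZl measurableT c ig).
have IZ (c : R) g : (seg h).-integrable setT (EFin \o g) ->
    \int[seg h]_r (c%:E * (g r)%:E) = c%:E * \int[seg h]_r (g r)%:E.
  by move=> ig; exact: integralZl.
have ik k : (seg h).-integrable setT (fun r => (U k 0 * gV k r - V k 0 * gU k r)%:E)%R.
  under eq_fun do rewrite EFinB 2!EFinM.
  by apply: integrableB => //; exact: iZl.
have wE : (Z h - Z 0 - \sum_(k < n) (U k 0 * V k h - V k 0 * U k h))%:E = \int[seg h]_r (w r)%:E.
  under eq_integral do rewrite /w EFinB -sumEFin.
  rewrite integralB //; last by apply: integrable_sum.
  rewrite -HZh EFinB; congr (_ - _).
  rewrite integral_sum // -sumEFin; apply: eq_bigr => k _.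
  under eq_integral do rewrite EFinB 2!EFinM.
  rewrite integralB //; [|exact: iZl..].
  rewrite !IZ // -HUh -HVh -!EFinM -EFinB; congr EFin; ring.
(* Pointwise majorant: an increment is at most [h |a| + h d] (or the same with [b]), and its
   deviation from the linear part at most [h d]. *)
pose maj k r := ((h * `|a k| + h * d) * `|gV k r - b k| + (h * `|b k| + h * d) * `|gU k r - a k|
  + h * d * (`|a k| + `|b k|))%R.
have mmaj k : measurable_fun setT (maj k).
  apply: measurable_funD => //; apply: measurable_funD.
    by apply: measurable_funM => //; apply: measurableT_comp => //; apply: measurable_funB => //; exact: meas.
  by apply: measurable_funM => //; apply: measurableT_comp => //; apply: measurable_funB => //; exact: meas.
have hd : (0 <= h * d)%R by rewrite mulr_ge0 // ltW.
have cU k : (0 <= h * `|a k| + h * d)%R by rewrite addr_ge0 // mulr_ge0 // ltW.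
have cV k : (0 <= h * `|b k| + h * d)%R by rewrite addr_ge0 // mulr_ge0 // ltW.
have maj0 k r : (0 <= maj k r)%R by rewrite !addr_ge0 // mulr_ge0 // addr_ge0.
have intmaj k : \int[seg h]_r (maj k r)%:E <= (2 * h * h * d * (`|a k| + `|b k| + d))%:E.
  have mdU : measurable_fun setT (fun r => `|gU k r - a k|%R).
    by apply: measurableT_comp => //; apply: measurable_funB => //; exact: meas.
  have mdV : measurable_fun setT (fun r => `|gV k r - b k|%R).
    by apply: measurableT_comp => //; apply: measurable_funB => //; exact: meas.
  pose A (r : measurableTypeR R) := (h * `|a k| + h * d)%:E * (`|gV k r - b k|%R)%:E.
  pose B (r : measurableTypeR R) := (h * `|b k| + h * d)%:E * (`|gU k r - a k|%R)%:E.
  pose C (r : measurableTypeR R) := (h * d * (`|a k| + `|b k|))%:E.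
  have A0 (r : measurableTypeR R) : setT r -> 0 <= A r by move=> _; rewrite mule_ge0 // lee_fin.
  have B0 (r : measurableTypeR R) : setT r -> 0 <= B r by move=> _; rewrite mule_ge0 // lee_fin.
  have AB0 (r : measurableTypeR R) : setT r -> 0 <= A r + B r by move=> _; rewrite adde_ge0 ?A0 ?B0.
  have C0 (r : measurableTypeR R) : setT r -> 0 <= C r by move=> _; rewrite lee_fin mulr_ge0 // addr_ge0.
  have mA : measurable_fun setT A.
    by apply: emeasurable_funM => //; exact/measurable_EFinP.
  have mB : measurable_fun setT B.
    by apply: emeasurable_funM => //; exact/measurable_EFinP.
  have mAB : measurable_fun setT (fun r : measurableTypeR R => A r + B r) by exact: emeasurable_funD.
  have mC : measurable_fun setT C by exact: measurable_cst.
  have -> : \int[seg h]_r (maj k r)%:E = \int[seg h]_r A r + \int[seg h]_r B r + \int[seg h]_r C r.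
    rewrite -(ge0_integralD _ measurableT A0 mA B0 mB) -(ge0_integralD _ measurableT AB0 mAB C0 mC).
    by apply: eq_integral.
  rewrite ge0_integralZl //; [|exact/measurable_EFinP|by rewrite lee_fin].
  rewrite ge0_integralZl //; [|exact/measurable_EFinP|by rewrite lee_fin].
  rewrite integral_cst //= (segTE (ltW h0)).
  apply: (@le_trans _ _ ((h * `|a k| + h * d)%:E * (h * d)%:E + (h * `|b k| + h * d)%:E * (h * d)%:E + (h * d * (`|a k| + `|b k|))%:E * h%:E)).
    by rewrite leeD2r // leeD // lee_wpmul2l // ?lee_fin.
  (* The three terms add up to exactly [2 h^2 d (|a| + |b| + d)]. *)
  by rewrite -!EFinM -!EFinD lee_fin; nra.
rewrite -lee_fin -abse_EFin wE.
have mw : measurable_fun setT w.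
  apply: measurable_funB; first exact: meas.
  apply: measurable_sum => k; apply: measurable_funB; apply: measurable_funM => //; exact: meas.
apply: le_trans (le_abse_integral _ _ _) _ => //; first exact/measurable_EFinP.
apply: (@le_trans _ _ (\int[seg h]_r \sum_(k < n) (maj k r)%:E)); last first.
  rewrite ge0_integral_sum; [|by []|by move=> k; exact: ((measurable_EFinP _ _).2 (mmaj k))|by move=> k r _; rewrite lee_fin].
  by rewrite -sumEFin; apply: lee_sum => k _.
apply: ae_ge0_le_integral.
- by [].
- by move=> r _; rewrite lee_fin.
- by apply/measurable_EFinP; exact: measurableT_comp.
- by move=> r _; rewrite sume_ge0 // => k _; rewrite lee_fin.
- by apply: emeasurable_sum => k; exact: ((measurable_EFinP _ _).2 (mmaj k)).
apply: ae_imp2 Hae (seg_ae h) => r [HU HV HZ] r0h _.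
rewrite sumEFin lee_fin /w HZ -sumrB.
apply: le_trans (ler_norm_sum _ _ _) _; apply: ler_sum => k _.
have rU := seg_deviation (iU k) r0h (HU k) (dU k).
have rV := seg_deviation (iV k) r0h (HV k) (dV k).
(* Each increment is split into its linear part and a deviation; the two terms [r a b] cancel, and
   every term left contains a deviation. *)
have -> : (U k r * gV k r - V k r * gU k r - (U k 0 * gV k r - V k 0 * gU k r) =
  (r * a k + (U k r - U k 0 - r * a k)) * (gV k r - b k) - (r * b k + (V k r - V k 0 - r * b k)) * (gU k r - a k)
  + ((U k r - U k 0 - r * a k) * b k - (V k r - V k 0 - r * b k) * a k))%R by ring.
rewrite /maj; move: rU rV.
move: (gV k r - b k)%R (gU k r - a k)%R (U k r - U k 0 - r * a k)%R (V k r - V k 0 - r * b k)%R.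
move: (a k) (b k) r0h => A B /andP[r0 rh] x y ru rv rU rV.
have P (c s z : R) : (`|s| <= h * d -> `|(r * c + s) * z| <= (h * `|c| + h * d) * `|z|)%R.
  move=> sd; rewrite normrM ler_wpM2r //; apply: le_trans (ler_normD _ _) _.
  by rewrite lerD // normrM ler_wpM2r // ger0_norm.
have Q (c s : R) : (`|s| <= h * d -> `|s * c| <= h * d * `|c|)%R.
  by move=> sd; rewrite normrM ler_wpM2r.
apply: le_trans (ler_normD _ _) _; apply: lerD.
  by apply: le_trans (ler_normB _ _) _; apply: lerD; exact: P.
apply: le_trans (ler_normB _ _) _.
by rewrite mulrDr addrC; apply: lerD; exact: Q.
Qed.

End side.

(** * The contact equation around a square *)

Section infimum.
Context d (X : measurableType d) (R : realType) (m : {measure set X -> \bar R}).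
Local Open Scope ereal_scope.

(** The infimum over [l] has an integral below every [e], so it vanishes almost everywhere. The
    index obtained depends on [x]. *)
Lemma ae_arbitrarily_small (T_ : nat -> X -> \bar R) :
  (forall l, measurable_fun setT (T_ l)) -> (forall l x, 0 <= T_ l x) ->
  (forall e : R, (0 < e)%R -> exists l, \int[m]_x T_ l x <= e%:E) ->
  {ae m, forall x, forall e : R, (0 < e)%R -> exists l, T_ l x < e%:E}.
Proof.
move=> mT T0 Tsmall; pose g x := einfs (T_^~ x) 0%N.
have mg : measurable_fun setT g by exact: measurable_fun_einfs.
have gT l x : g x <= T_ l x by apply: ereal_inf_lbound; exists l.
have g0 x : 0 <= g x by apply: le_ereal_inf_tmp => _ [l _ <-].
have : ae_eq m setT g (cst 0).
  apply/ae_eq_integral_abs => //; apply/eqP; rewrite eq_le integral_ge0 ?andbT //.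
  apply/lee_addgt0Pr => e e0; rewrite add0e; have [l Tl] := Tsmall _ e0.
  apply: le_trans Tl; apply: ge0_le_integral => //.
  - exact: measurableT_comp.
  - by move=> x _; rewrite gee0_abs.
apply: ae_imp => x /(_ Logic.I) gx e e0.
have : g x < e%:E by rewrite gx lte_fin.
by move=> /ereal_inf_lt[_ [l _ <-] Tl]; exists l.
Qed.

End infimum.

(** * Mean deviation on segments *)

Section deviation.
Context {R : realType} (m : nat).
Local Open Scope ereal_scope.
Local Notation T := 'rV[R]_m.

(** The reference value is [G x] even when the segment starts at [x + w], so that opposite sides of
    a square are compared with the same numbers. There is no division by the length [h]. *)
Definition dev (G : T -> R) (v w : T) (h : R) (x : T) :=
  \int[seg h]_t (`|G (x + w + t *: v) - G x|%R)%:E.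

Variables (G : T -> R).
Hypothesis iG : (mu m).-integrable setT (EFin \o G).

Lemma measurable_dev_fun v w : measurable_fun setT
  (fun z : T * measurableTypeR R => (`|G (z.1 + w + z.2 *: v) - G z.1|%R)%:E).
Proof.
have mG := measurable_integrable iG.
apply/measurable_EFinP; apply: measurableT_comp => //; apply: measurable_funB.
  apply: (measurableT_comp mG); apply: measurable_line => //.
  exact: (measurableT_comp (measurable_shift w) measurable_fst).
exact: (measurableT_comp mG measurable_fst).
Qed.

Lemma measurable_dev v w h : measurable_fun setT (dev G v w h).
Proof.
apply: (@measurable_fun_fubini_tonelli_F _ _ _ _ _ (seg h) _ (measurable_dev_fun v w)).
by move=> z; rewrite lee_fin.
Qed.

Lemma dev_ge0 v w h x : 0 <= dev G v w h x.
Proof. by apply: integral_ge0 => t _; rewrite lee_fin. Qed.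

(** After Tonelli the inner integral is the [L^1] distance from [G] to a double translate, by [c w]
    and [t v], with coefficients at most [h]. The factor [h] is the length of the segment. *)
Lemma integral_dev_small (v w : T) (e : R) : (0 < e)%R ->
  exists2 del : R, (0 < del)%R & forall h c : R, (0 < h <= del)%R -> (0 <= c <= h)%R ->
    \int[mu m]_x dev G v (c *: w) h x <= (h * e)%:E.
Proof.
move=> e0; have e20 : (0 < e / 2)%R by rewrite divr_gt0.
have mG := measurable_integrable iG.
have [_ /(_ _ e20)[d1 d10 H1]] := L1cont_integrable v iG.
have [_ /(_ _ e20)[d2 d20 H2]] := L1cont_integrable w iG.
exists (Num.min d1 d2); first by rewrite lt_min d10.
move=> h c /andP[h0]; rewrite le_min => /andP[h1 h2] /andP[c0 ch].
rewrite (@fubini_tonelli _ _ _ _ _ (mu m) (seg h) _ (measurable_dev_fun v (c *: w))); last first.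
  by move=> z; rewrite lee_fin.
apply: (@le_trans _ _ (\int[seg h]_t e%:E)); last first.
  by rewrite integral_cst //= (segTE (ltW h0)) -EFinM mulrC.
apply: ae_ge0_le_integral.
- by [].
- by move=> t _; apply: integral_ge0 => x _; rewrite lee_fin.
- apply: (@measurable_fun_fubini_tonelli_G _ _ _ _ _ (mu m) _ (measurable_dev_fun v (c *: w))).
  by move=> z; rewrite lee_fin.
- by move=> t _; rewrite lee_fin ltW.
- exact: measurable_cst.
apply: ae_imp (seg_ae h) => t /andP[t0 th] _.
have mGt := measurable_integrable (integrable_transl v t iG).
have mGc := measurable_integrable (integrable_transl w c iG).
have mGct := measurable_integrable (integrable_transl w c (integrable_transl v t iG)).
change (L1dist (transl w c (transl v t G)) G <= e%:E).
apply: le_trans (L1dist_triangle mGct mGc mG) _.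
rewrite L1dist_transl // (splitr e) EFinD; apply: leeD.
  by apply: H1; rewrite ger0_norm //; exact: le_trans th h1.
by apply: H2; rewrite ger0_norm //; apply: le_trans ch _.
Qed.

End deviation.

Section square.
Context {R : realType}.
Implicit Types a b c e h d : R.

Lemma product_perturbation h d a e r s : 0 < h -> `|r| <= h * d -> `|s| <= h * d ->
  `|(h * a + r) * (h * e + s) - h * h * a * e| <= h * h * d * (`|a| + `|e| + d).
Proof.
move=> h0 rd sd.
have -> : (h * a + r) * (h * e + s) - h * h * a * e = h * a * s + h * e * r + r * s by ring.
have P (x y : R) : `|y| <= h * d -> `|h * x * y| <= h * h * d * `|x|.
  move=> yd; rewrite !normrM (gtr0_norm h0).
  have hx : 0 <= h * `|x| by rewrite mulr_ge0 // ltW.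
  by have := ler_wpM2l hx yd; lra.
have h1 := P a s sd; have h2 := P e r rd.
have h3 : `|r * s| <= h * d * (h * d) by rewrite normrM ler_pM.
have := ler_normD (h * a * s + h * e * r) (r * s); have := ler_normD (h * a * s) (h * e * r).
lra.
Qed.

(* The shoelace sum of a quadrilateral with corners numbered 0, 1, 2, 3 in
   cyclic order, whose sides are close to those of the parallelogram spanned
   by [h (a, b)] and [h (c, e)]. *)
Lemma shoelace_perturbation h d a b c e (U0 U1 U2 U3 V0 V1 V2 V3 : R) :
  0 < h -> 0 <= d ->
  `|U1 - U0 - h * a| <= h * d -> `|V1 - V0 - h * b| <= h * d ->
  `|U3 - U0 - h * c| <= h * d -> `|V3 - V0 - h * e| <= h * d ->
  `|U2 - U1 - h * c| <= h * d -> `|V2 - V1 - h * e| <= h * d ->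
  `|(U0 * V1 - V0 * U1) + (U1 * V2 - V1 * U2) - (U3 * V2 - V3 * U2) - (U0 * V3 - V0 * U3)
    - 2 * (h * h * (a * e - b * c))| <=
  h * h * d * (4 * (`|a| + `|b| + `|c| + `|e|) + 6 * d).
Proof.
move=> h0 d0 u1 v1 u3 v3 u2 v2.
(* Relative to corner 0 the shoelace sum is a signed sum of six products of increments. Four have
   leading terms [h^2 a e] or [- h^2 b c], twice each; the leading terms [h^2 c e] of the other two
   cancel. *)
have p1 := product_perturbation a e h0 u1 v2.
have p2 := product_perturbation b c h0 v1 u2.
have p3 := product_perturbation a e h0 u1 v3.
have p4 := product_perturbation b c h0 v1 u3.
have p5 := product_perturbation c e h0 u2 v3.
have p6 := product_perturbation e c h0 v2 u3.
have K0 : 0 <= h * h * d by rewrite mulr_ge0 // mulr_ge0 // ltW.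
have Ka : 0 <= h * h * d * `|a| by rewrite mulr_ge0.
have Kb : 0 <= h * h * d * `|b| by rewrite mulr_ge0.
move: p1 p2 p3 p4 p5 p6; rewrite !ler_norml => p1 p2 p3 p4 p5 p6.
by apply/andP; split; lra.
Qed.

End square.

Section contact.
Context {R : realType} (m n : nat).
Local Open Scope ereal_scope.
Local Notation T := 'rV[R]_m.
Variables (p q : T) (U V : 'I_n -> T -> R) (Z : T -> R)
  (dU dV : 'I_n -> 'I_m -> T -> R) (dZ : 'I_m -> T -> R).
Hypotheses (iU : forall k, (mu m).-integrable setT (EFin \o U k))
  (iV : forall k, (mu m).-integrable setT (EFin \o V k))
  (iZ : (mu m).-integrable setT (EFin \o Z))
  (idU : forall k i, (mu m).-integrable setT (EFin \o dU k i))
  (idV : forall k i, (mu m).-integrable setT (EFin \o dV k i))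
  (idZ : forall i, (mu m).-integrable setT (EFin \o dZ i))
  (wU : forall k i, weakd p q (U k) (dU k i) i)
  (wV : forall k i, weakd p q (V k) (dV k i) i)
  (wZ : forall i, weakd p q Z (dZ i) i)
  (contact : {ae mu m, forall x, box p q x -> forall i,
     dZ i x = (\sum_(k < n) (U k x * dV k i x - V k x * dU k i x))%R}).
Local Notation e := (@ebasis R m).

(** The comparison values [a] and [b] are free, so that the estimate can be used at a shifted corner
    with the derivatives taken at the original one. *)
Definition side_conclusion i h x := forall (a b : 'I_n -> R) (d : R), (0 <= d)%R ->
  (forall k, \int[seg h]_t (`|dU k i (x + t *: e i) - a k|%R)%:E <= (h * d)%:E) ->
  (forall k, \int[seg h]_t (`|dV k i (x + t *: e i) - b k|%R)%:E <= (h * d)%:E) ->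
  [/\ forall k, (`|U k (x + h *: e i) - U k x - h * a k| <= h * d)%R,
      forall k, (`|V k (x + h *: e i) - V k x - h * b k| <= h * d)%R &
      (`|Z (x + h *: e i) - Z x -
         \sum_(k < n) (U k x * V k (x + h *: e i) - V k x * U k (x + h *: e i))| <=
       \sum_(k < n) 2 * h * h * d * (`|a k| + `|b k| + d))%R].

Lemma side_ae i h : (0 < h)%R ->
  {ae mu m, forall x, box p (q - h *: e i) x -> side_conclusion i h x}.
Proof.
move=> h0; have hh : (0 <= h <= h)%R by rewrite (ltW h0) lexx.
have A1 := ae_forall (fun k => ftc_ae (iU k) (idU k i) (wU k (i := i)) h0).
have A2 := ae_forall (fun k => ftc_ae (iV k) (idV k i) (wV k (i := i)) h0).
have A3 := ftc_ae iZ (idZ i) (@wZ i) h0.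
have B1 := ae_forall (fun k => ftc_ae_line h (iU k) (idU k i) (wU k (i := i))).
have B2 := ae_forall (fun k => ftc_ae_line h (iV k) (idV k i) (wV k (i := i))).
have B3 := ae_line h (e i) contact.
have C1 := ae_forall (fun k => ae_integrable1 (integrable_shift_line (e i) h (idU k i))).
have C2 := ae_forall (fun k => ae_integrable1 (integrable_shift_line (e i) h (idV k i))).
have C3 := ae_integrable1 (integrable_shift_line (e i) h (idZ i)).
apply: ae_imp2 A1 (ae_imp2 _ A2 (ae_imp2 _ A3 (ae_imp2 _ B1 (ae_imp2 _ B2 (ae_imp2 _ B3
  (ae_imp2 _ C1 (ae_imp2 (fun _ => @conj _ _) C2 C3)))))));
  [|move=> x; exact: (@conj _ _)..].
move=> x a1 [a2 [a3 [b1 [b2 [b3 [c1 [c2 c3]]]]]]] xQ a b d d0 dUa dVb.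
have E0 (F : T -> R) : F x = F (x + 0 *: e i)%R by rewrite scale0r addr0.
split.
- by move=> k; apply: (seg_deviation (c1 k) hh (a1 k xQ)).
- by move=> k; apply: (seg_deviation (c2 k) hh (a2 k xQ)).
rewrite (E0 Z); under eq_bigr do rewrite (E0 (U _)) (E0 (V _)).
apply: (@side_estimate _ h h0 n (fun k r => U k (x + r *: e i)%R) (fun k r => V k (x + r *: e i)%R)
  (fun k r => dU k i (x + r *: e i)%R) (fun k r => dV k i (x + r *: e i)%R)
  (fun r => Z (x + r *: e i)%R) (fun r => dZ i (x + r *: e i)%R)) => //.
- have b1' := ae_forall b1; have b2' := ae_forall b2.
  apply: ae_imp2 (ae_imp2 (fun _ => @conj _ _) b1' b2') (ae_imp2 (fun _ => @conj _ _) b3 (seg_ae h)).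
  move=> r [u1 u2] [u3 /andP[r0 rh]]; split => [k|k|]; rewrite -?E0.
  + exact: u1.
  + exact: u2.
  apply: u3 => k; have := xQ k; rewrite !mxE eqxx /=.
  by case: (k == i) => /=; lra.
- by move=> k; rewrite -E0; exact: a1.
- by move=> k; rewrite -E0; exact: a2.
- by rewrite -E0; exact: a3.
Qed.

(** After division by [h^2], the side errors and the shoelace error are at most [d] times a constant
    that depends only on the derivatives at [x], so arbitrarily small [d] forces the form to
    vanish. *)
Lemma isotropic_at i j x : (forall eps : R, (0 < eps)%R -> exists h d : R,
    [/\ (0 < h)%R, (0 <= d)%R, (d <= eps)%R, (d <= 1)%R &
    [/\ forall k, dev (dU k i) (e i) 0 h x <= (h * d)%:E /\ dev (dV k i) (e i) 0 h x <= (h * d)%:E,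
        forall k, dev (dU k j) (e j) 0 h x <= (h * d)%:E /\ dev (dV k j) (e j) 0 h x <= (h * d)%:E,
        forall k, dev (dU k i) (e i) (h *: e j) h x <= (h * d)%:E /\
          dev (dV k i) (e i) (h *: e j) h x <= (h * d)%:E,
        forall k, dev (dU k j) (e j) (h *: e i) h x <= (h * d)%:E /\
          dev (dV k j) (e j) (h *: e i) h x <= (h * d)%:E &
        [/\ side_conclusion i h x, side_conclusion j h x,
            side_conclusion i h (x + h *: e j)%R & side_conclusion j h (x + h *: e i)%R]]]) ->
  (\sum_(k < n) (dU k i x * dV k j x - dV k i x * dU k j x) = 0)%R.
Proof.
move=> H; pose A k := dU k i x; pose B k := dV k i x; pose C k := dU k j x; pose E k := dV k j x.
(* With [s] the sum of the four absolute values, the side errors contribute [4 s + 8 d] and the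
   shoelace error [4 s + 6 d]; then [d <= 1] is used. *)
pose M := (\sum_(k < n) (8 * (`|A k| + `|B k| + `|C k| + `|E k|) + 14))%R.
have M0 : (0 <= M)%R.
  by apply: sumr_ge0 => k _; rewrite addr_ge0 // mulr_ge0 // !addr_ge0.
set S := (\sum_(k < n) _)%R.
suff HS eps : (0 < eps)%R -> (`|2 * S| <= eps * M)%R.
  apply/eqP; rewrite -normr_eq0 eq_le normr_ge0 andbT.
  apply/ler_addgt0Pr => eps eps0; rewrite add0r.
  have e1 : (0 < eps / (M + 1))%R by rewrite divr_gt0 // ltr_wpDl.
  have := HS _ e1; rewrite normrM (ger0_norm (x := 2%R)) // => H2.
  have H3 : (eps / (M + 1) * M <= eps)%R.
    by rewrite mulrAC ler_pdivrMr ?ltr_wpDl // ler_wpM2l ?(ltW eps0) // lerDl.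
  by have := normr_ge0 S; lra.
move=> eps0; have [h [d [h0 d0 deps d1 [Di Dj Dij Dji [Si Sj Sij Sji]]]]] := H _ eps0.
have z (y : T) : (y + 0)%R = y by rewrite addr0.
have [Ui Vi Zi] := Si A B d d0 (fun k => ltac:(have := (Di k).1; rewrite /dev z; exact))
  (fun k => ltac:(have := (Di k).2; rewrite /dev z; exact)).
have [Uj Vj Zj] := Sj C E d d0 (fun k => ltac:(have := (Dj k).1; rewrite /dev z; exact))
  (fun k => ltac:(have := (Dj k).2; rewrite /dev z; exact)).
have [Uij Vij Zij] := Sij A B d d0 (fun k => (Dij k).1) (fun k => (Dij k).2).
have [Uji Vji Zji] := Sji C E d d0 (fun k => (Dji k).1) (fun k => (Dji k).2).
have comm : (x + h *: e j + h *: e i = x + h *: e i + h *: e j)%R by rewrite addrAC.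
rewrite comm in Zij.
set p1 := (x + h *: e i)%R in Ui Vi Zi Uji Vji Zji Zij.
set p3 := (x + h *: e j)%R in Uj Vj Zj Uij Vij Zij.
set p2 := (p1 + h *: e j)%R in Uji Vji Zji Zij.
pose Q k := ((U k x * V k p1 - V k x * U k p1) + (U k p1 * V k p2 - V k p1 * U k p2)
  - (U k p3 * V k p2 - V k p3 * U k p2) - (U k x * V k p3 - V k x * U k p3))%R.
have Qb k : (`|Q k - 2 * (h * h * (A k * E k - B k * C k))| <=
    h * h * d * (4 * (`|A k| + `|B k| + `|C k| + `|E k|) + 6 * d))%R.
  exact: shoelace_perturbation.
have SQ : (`|\sum_(k < n) Q k| <= \sum_(k < n) h * h * d * (4 * (`|A k| + `|B k| + `|C k| + `|E k|) + 8 * d))%R.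
  have -> : (\sum_(k < n) Q k = \sum_(k < n) (U k x * V k p1 - V k x * U k p1)
      + \sum_(k < n) (U k p1 * V k p2 - V k p1 * U k p2)
      - \sum_(k < n) (U k p3 * V k p2 - V k p3 * U k p2)
      - \sum_(k < n) (U k x * V k p3 - V k x * U k p3))%R.
    by rewrite -big_split -sumrB -sumrB.
  move: Zi Zj Zij Zji.
  set z01 := (\sum_(k < n) (U k x * V k p1 - V k x * U k p1))%R.
  set z03 := (\sum_(k < n) (U k x * V k p3 - V k x * U k p3))%R.
  set z32 := (\sum_(k < n) (U k p3 * V k p2 - V k p3 * U k p2))%R.
  set z12 := (\sum_(k < n) (U k p1 * V k p2 - V k p1 * U k p2))%R.
  set s1 := (\sum_(k < n) 2 * h * h * d * (`|A k| + `|B k| + d))%R.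
  set s2 := (\sum_(k < n) 2 * h * h * d * (`|C k| + `|E k| + d))%R.
  rewrite (_ : (\sum_(k < n) h * h * d * (4 * (`|A k| + `|B k| + `|C k| + `|E k|) + 8 * d))%R = (2 * s1 + 2 * s2)%R); last first.
    by rewrite /s1 /s2 !mulr_sumr -big_split /=; apply: eq_bigr => k _; ring.
  rewrite !ler_norml => /andP[? ?] /andP[? ?] /andP[? ?] /andP[? ?].
  by apply/andP; split; lra.
have hh0 : (0 < h * h)%R by rewrite mulr_gt0.
suff : (h * h * `|2 * S| <= h * h * (eps * M))%R by rewrite ler_pM2l.
apply: (@le_trans _ _ (h * h * (d * M))%R); last by rewrite !ler_pM2l // ler_wpM2r.
have -> : (h * h * `|2 * S| = `|\sum_(k < n) 2 * (h * h * (A k * E k - B k * C k))|)%R.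
  rewrite -[X in (X * `|2 * S|)%R](gtr0_norm hh0) -normrM; congr `|_|%R.
  by rewrite /S 2!mulr_sumr; apply: eq_bigr => k _; rewrite /A /B /C /E; ring.
have -> : (\sum_(k < n) 2 * (h * h * (A k * E k - B k * C k)) =
    \sum_(k < n) Q k - \sum_(k < n) (Q k - 2 * (h * h * (A k * E k - B k * C k))))%R.
  by rewrite -sumrB; apply: eq_bigr => k _; ring.
apply: le_trans (ler_normB _ _) _.
apply: le_trans (lerD SQ (le_trans (ler_norm_sum _ _ _) (ler_sum _ (fun k _ => Qb k)))) _.
rewrite -big_split /= /M 2!mulr_sumr; apply: ler_sum => k _.
rewrite [leRHS]mulrA -mulrDr; apply: ler_wpM2l; first by rewrite mulr_ge0 // ltW.
by lra.
Qed.

(** All deviations are summed into one function [T_ l], divided by the side length, so that a single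
    index [l] serves every component and all four sides. The margin [eta] keeps the squares inside
    [box p q]. *)
Lemma isotropic_ae i j (eta : R) : (0 < eta)%R ->
  {ae mu m, forall x, box p (q - const_mx eta) x ->
    (\sum_(k < n) (dU k i x * dV k j x - dV k i x * dU k j x) = 0)%R}.
Proof.
move=> eta0.
(* An index is a component, the choice of [dU] or [dV], the direction [i] or [j], and whether the
   side is the shifted one. *)
pose J := ('I_n * bool * bool * bool)%type.
(* Half of [eta], because the far corner is two sides away from [x], in the same direction if
   [i = j]. *)
pose hl (l : nat) := (eta / 2 * l.+1%:R^-1)%R.
have hl0 l : (0 < hl l)%R by rewrite mulr_gt0 // divr_gt0.
have hle l : (hl l <= eta / 2)%R.
  by rewrite ler_piMr ?divr_ge0 ?(ltW eta0) // invf_le1 // ler1n.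
pose Gt (t : J) := let: (k, c, dr, sh) := t in
  (if c then dU else dV) k (if dr then i else j).
have iGt t : (mu m).-integrable setT (EFin \o Gt t).
  by case: t => -[[k []] dr] sh; [exact: idU|exact: idV].
pose vt (t : J) := let: (k, c, dr, sh) := t in e (if dr then i else j).
pose wt (t : J) := let: (k, c, dr, sh) := t in e (if dr then j else i).
pose ct (t : J) (h : R) := let: (k, c, dr, sh) := t in if sh then h else 0%R.
pose D h (t : J) x := dev (Gt t) (vt t) (ct t h *: wt t) h x.
pose T_ l x := ((hl l)^-1)%:E * \sum_t D (hl l) t x.
have D0 h t x : 0 <= D h t x by exact: dev_ge0.
have mD h t : measurable_fun setT (D h t) by exact: measurable_dev.
have hi0 l : (0 <= (hl l)^-1)%R by rewrite invr_ge0 ltW.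
have small : {ae mu m, forall x, forall d : R, (0 < d)%R -> exists l, T_ l x < d%:E}.
  apply: ae_arbitrarily_small.
  - by move=> l; apply: emeasurable_funM => //; exact: emeasurable_sum.
  - by move=> l x; rewrite mule_ge0 ?lee_fin // sume_ge0.
  move=> d d0; pose d' := (d / (#|{: J}|%:R + 1))%R.
  have d'0 : (0 < d')%R by rewrite divr_gt0 // ltr_wpDl.
  have near_t : \forall l \near \oo, forall t, \int[mu m]_x D (hl l) t x <= (hl l * d')%:E.
    apply: filter_forall => t.
    have [del del0 Hdel] := integral_dev_small (iGt t) (vt t) (wt t) d'0.
    have del2 : (0 < del / (eta / 2))%R by rewrite divr_gt0 // divr_gt0.
    apply: filterS (near_infty_natSinv_lt (PosNum del2)) => l /= Hl.
    apply: Hdel.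
      rewrite hl0 /= /hl mulrC -ler_pdivlMr ?divr_gt0 //; exact: ltW.
    by case: t => -[[k c] dr] [] /=; rewrite ?lexx ?ltW.
  have [l _ Hl] := near_t; exists l.
  rewrite /T_ ge0_integralZl //; last 3 first.
  - exact: emeasurable_sum.
  - by move=> x _; rewrite sume_ge0.
  - by rewrite lee_fin.
  rewrite ge0_integral_sum //.
  apply: (@le_trans _ _ (((hl l)^-1)%:E * \sum_(t : J) (hl l * d')%:E)).
    by rewrite lee_wpmul2l ?lee_fin //; apply: lee_sum => t _; exact: (Hl l (leqnn l)).
  rewrite sumEFin sumr_const -EFinM lee_fin -mulr_natr mulrA mulrA mulVf ?gt_eqF // mul1r.
  rewrite /d' mulrAC ler_pdivrMr ?ltr_wpDl // ler_wpM2l ?(ltW d0) //.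
  by rewrite lerDl.
(* Only countably many side lengths occur, so one null set serves them all. *)
have aeN (P : nat -> T -> Prop) : (forall l, {ae mu m, forall x, P l x}) ->
    {ae mu m, forall x, forall l, P l x} by exact: ae_foralln.
have Si := aeN _ (fun l => side_ae i (hl0 l)).
have Sj := aeN _ (fun l => side_ae j (hl0 l)).
have Sij := aeN _ (fun l => ae_shift (hl l *: e j)%R (side_ae i (hl0 l))).
have Sji := aeN _ (fun l => ae_shift (hl l *: e i)%R (side_ae j (hl0 l))).
apply: ae_imp2 small (ae_imp2 (fun _ => @conj _ _) (ae_imp2 (fun _ => @conj _ _) Si Sj)
  (ae_imp2 (fun _ => @conj _ _) Sij Sji)).
move=> x sm [[si sj] [sij sji]] xQ; apply: isotropic_at => eps eps0.
pose d := Num.min eps 1%R.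
have d0 : (0 < d)%R by rewrite lt_min eps0 /=.
have [l Tl] := sm _ d0; exists (hl l), d; set h := hl l.
have Dl t : D h t x <= (h * d)%:E.
  apply: (@le_trans _ _ (\sum_t D h t x)).
    by rewrite (bigD1 t) //= leeDl // sume_ge0.
  have -> : \sum_t D h t x = h%:E * T_ l x.
    by rewrite /T_ muleA -EFinM mulfV ?mul1e // gt_eqF // hl0.
  by rewrite [leRHS]EFinM; apply: lee_wpmul2l; [rewrite lee_fin ltW // hl0|exact: ltW].
have h2 : (0 < h <= eta / 2)%R by rewrite hl0 hle.
have inQ (y : T) i' : (forall k, p ord0 k <= y ord0 k <= x ord0 k + h)%R -> box p (q - h *: e i') y.
  move=> yP k; have := yP k; have := xQ k; rewrite !mxE eqxx /=.
  by case: (k == i') => /=; lra.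
have xP k : (p ord0 k <= x ord0 k)%R by have /andP[] := xQ k.
have xh i' k : (p ord0 k <= (x + h *: e i')%R ord0 k <= x ord0 k + h)%R.
  by have := xP k; rewrite !mxE eqxx /=; case: (k == i') => /=; lra.
have xx k : (p ord0 k <= x ord0 k <= x ord0 k + h)%R by have := xP k; lra.
split; [exact: hl0|exact: ltW|by rewrite ge_min lexx|by rewrite ge_min lexx orbT|].
split => [k|k|k|k|].
- by have := Dl (k, true, true, false); have := Dl (k, false, true, false);
    rewrite /D /= scale0r.
- by have := Dl (k, true, false, false); have := Dl (k, false, false, false);
    rewrite /D /= scale0r.
- by have := Dl (k, true, true, true); have := Dl (k, false, true, true); rewrite /D /=.
- by have := Dl (k, true, false, true); have := Dl (k, false, false, true); rewrite /D /=.
- split.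
  + exact: si (inQ _ _ xx).
  + exact: sj (inQ _ _ xx).
  + exact: sij (inQ _ _ (xh j)).
  + exact: sji (inQ _ _ (xh i)).
Qed.

End contact.

(** * Rank of the Jacobian matrix *)

Section isotropic_rank.
Context {F : fieldType} (n m : nat).

(** Symplectic rotation of the stacked matrix gives [col_mx B (- A)], whose rank is no smaller and
    which the transpose of [col_mx A B] annihilates. The two ranks add up to at most [n + n]. *)
Lemma rank_isotropic (A B : 'M[F]_(n, m)) :
  A^T *m B = B^T *m A -> (\rank (col_mx A B) <= n)%N.
Proof.
move=> AB.
have /mulmx0_rank_max : (col_mx A B)^T *m col_mx B (- A) = 0.
  by rewrite tr_col_mx mul_row_col mulmxN AB subrr.
rewrite mxrank_tr => H.
have : (\rank (col_mx A B) <= \rank (col_mx B (- A)))%N.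
  apply: mxrankS; rewrite col_mx_sub; apply/andP; split.
    rewrite -addsmxE; apply: submx_trans (addsmxSr _ _).
    have {1}-> : A = -1 *: - A by rewrite scaleN1r opprK.
    exact: scalemx_sub.
  by rewrite -addsmxE; exact: addsmxSl.
lia.
Qed.

Lemma rank_contact (M : 'M[F]_((2 * n).+1, m)) (c d : 'I_n -> F) :
  (forall i j, \sum_(k < n) (M (inord k) i * M (inord (k + n)) j
     - M (inord (k + n)) i * M (inord k) j) = 0) ->
  (forall i, M (inord (2 * n)) i =
     \sum_(k < n) (c k * M (inord (k + n)) i - d k * M (inord k) i)) ->
  (\rank M <= n)%N.
Proof.
move=> iso last.
pose A := \matrix_(k < n, i < m) M (inord k) i.
pose B := \matrix_(k < n, i < m) M (inord (k + n)) i.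
have AB : A^T *m B = B^T *m A.
  apply/matrixP => i j; apply/eqP; rewrite -subr_eq0 -[X in _ == X](iso i j); apply/eqP.
  by rewrite !mxE -sumrB; apply: eq_bigr => k _; rewrite !mxE.
apply: leq_trans (rank_isotropic AB); apply: mxrankS.
have AD : (A <= col_mx A B)%MS by rewrite -addsmxE; exact: addsmxSl.
have BD : (B <= col_mx A B)%MS by rewrite -addsmxE; exact: addsmxSr.
apply/row_subP => r.
have rA (k : 'I_n) : row (inord k : 'I_(2 * n).+1) M = row k A.
  by apply/rowP => i; rewrite !mxE.
have rB (k : 'I_n) : row (inord (k + n) : 'I_(2 * n).+1) M = row k B.
  by apply/rowP => i; rewrite !mxE.
have [rn|nr] := ltnP r n.
  have -> : r = inord (Ordinal rn) by apply: val_inj; rewrite /= inordK.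
  by rewrite rA; apply: submx_trans AD; exact: row_sub.
have [r2n|n2r] := ltnP r (2 * n).
  have rn' : (r - n < n)%N by lia.
  have -> : r = inord (Ordinal rn' + n) by apply: val_inj; rewrite /= subnK // inordK.
  by rewrite rB; apply: submx_trans BD; exact: row_sub.
have -> : r = inord (2 * n).
  apply: val_inj; rewrite /= inordK //; apply/eqP; rewrite eqn_leq n2r andbT.
  by rewrite -ltnS ltn_ord.
have -> : row (inord (2 * n)) M = \sum_(k < n) (c k *: row k B - d k *: row k A).
  by apply/rowP => i; rewrite !mxE last summxE; apply: eq_bigr => k _; rewrite !mxE.
apply: summx_sub => k _; apply: addmx_sub; rewrite ?eqmx_opp; apply: scalemx_sub.
  by apply: submx_trans BD; exact: row_sub.
by apply: submx_trans AD; exact: row_sub.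
Qed.

End isotropic_rank.

(** * Localisation to boxes *)

Section cutoff.
Context {R : realType} (m : nat) (Omega : set 'rV[R]_m).
Local Open Scope ereal_scope.
Local Notation T := 'rV[R]_m.
Variables (p q : T).
Hypothesis pqO : box p q `<=` Omega.

(** Makes a locally integrable function integrable on the whole space. Weak differentiability may
    fail across the faces, but [weakd p q] tests only inside the box. *)
Definition cut (g : T -> R) (x : T) : R := (\1_(box p q) x * g x)%R.

Lemma cutE g x : box p q x -> cut g x = g x.
Proof. by move=> xQ; rewrite /cut indicE mem_set // mul1r. Qed.

Lemma cut_out g x : ~ box p q x -> cut g x = 0%R.
Proof. by move=> xQ; rewrite /cut indicE memNset // mul0r. Qed.

Lemma integrable_cut g : loc_int Omega g -> (mu m).-integrable setT (EFin \o cut g).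
Proof.
move=> [bg ig]; have mQ := measurable_box p q.
have mcut : measurable_fun setT (cut g).
  apply: (measurability _ (measurable_realfun.RGenOpens.measurableE R)).
  move=> _ [_ [a [b ->] <-]]; rewrite setTI; set W := `]a, b[%classic.
  (* Borel measurability of [g] is known only on [Omega], so the preimage is split along the box,
     off which [cut g] is constant. *)
  have -> : cut g @^-1` W = (box p q `&` (Omega `&` g @^-1` W)) `|` (~` box p q `&` [set _ | W 0%R]).
    apply/seteqP; split => x /=.
      have [xQ|xQ] := pselect (box p q x).
        by rewrite cutE // => Wg; left; split => //; split => //; exact: pqO.
      by rewrite cut_out // => W0; right.
    by case=> [[xQ [_ Wg]]|[xQ W0]]; [rewrite cutE|rewrite cut_out].
  apply: measurableU; first by apply: measurableI => //; apply: bg; exact: interval_open.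
  apply: measurableI; first exact: measurableC.
  have [W0|W0] := pselect (W 0%R).
    by rewrite (_ : [set _ | _] = setT) //; apply/seteqP; split.
  by rewrite (_ : [set _ | _] = set0) //; apply/seteqP; split.
apply/integrableP; split; first exact/measurable_EFinP.
have E : (fun x => `|(EFin \o cut g) x|) = (fun x => (\1_(box p q) x * `|g x|)%:E).
  by apply/funext => x /=; rewrite /cut normrM ger0_norm.
rewrite E -ge0_iint_mu.
- by apply: ig => //; exact: compact_box.
- by rewrite -E; apply: measurableT_comp => //; exact/measurable_EFinP.
- by move=> x; rewrite lee_fin mulr_ge0.
Qed.

Lemma bounded_continuous_supported (psi : T -> R) (a b : T) : continuous psi ->
  (forall x, ~ box a b x -> psi x = 0%R) -> [bounded psi x | x in setT].
Proof.
move=> cpsi psi0.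
have /compact_bounded[M [Mr HM]] : compact (psi @` box a b).
  by apply: continuous_compact; [exact: continuous_subspaceT|exact: compact_box].
exists (Num.max M 0%R); split; first exact: num_real.
move=> N; rewrite gt_max => /andP[MN N0] x _ /=.
have [xQ|xQ] := pselect (box a b x); first by apply: (HM N MN); exists x.
by rewrite psi0 // normr0 ltW.
Qed.

(** A product test function supported in [box p q] does not see the cutoff, and the products with it
    are integrable, so both [iint] are integrals against [mu m]. *)
Lemma weakd_cut (f g : T -> R) (i : 'I_m) : loc_int Omega f -> loc_int Omega g ->
  (forall phi, test_fun Omega phi ->
     iint (fun x => (f x * pderiv i phi x)%:E) = - iint (fun x => (g x * phi x)%:E)) ->
  weakd p q (cut f) (cut g) i.
Proof.
move=> lf lg weak eta a b g' seta eta0 abpq dg'.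
have [g'' [dg'' sg'']] := smooth1_derive (seta i).
have g'E : g' = g''.
  apply/funext => t; rewrite -(@derive_val _ _ _ _ _ _ _ (dg' t)).
  exact: (@derive_val _ _ _ _ _ _ _ (dg'' t)).
have sg' : smooth1 g' by rewrite g'E.
(* Outside the closed interval [eta i] vanishes in a neighbourhood, hence so does its derivative;
   this matches the closed box in [psi_out]. *)
have g'0 t : ~~ (a ord0 i <= t <= b ord0 i)%R -> g' t = 0%R.
  move=> tab; have : is_derive t 1%R (eta i) 0%R.
    have c0 : is_derive t 1%R (cst 0%R : R -> R) 0%R by exact: is_derive_cst.
    apply: near_eq_is_derive c0.
    move: tab; rewrite negb_and -!ltNge => /orP[ta|bt].
      near=> s; rewrite eta0 // negb_and -!leNgt; apply/orP; left; apply: ltW; near: s.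
      exact: lt_nbhsl.
    near=> s; rewrite eta0 // negb_and -!leNgt; apply/orP; right; apply: ltW; near: s.
    exact: lt_nbhsr.
  move=> d0; rewrite -(@derive_val _ _ _ _ _ _ _ (dg' t)).
  exact: (@derive_val _ _ _ _ _ _ _ d0).
have phi_out x : ~ box a b x -> prodf eta x = 0%R by exact: prodf_out.
have psi_out x : ~ box a b x -> prodf (upd eta i g') x = 0%R.
  move=> /existsNP[k /negP xk]; rewrite /prodf (bigD1 k) //= /upd.
  case: eqP => [ki|_]; first by rewrite g'0 ?mul0r // -ki.
  rewrite eta0 ?mul0r //; apply: contra xk => /andP[/ltW -> /ltW ->] //.
have pdE : pderiv i (prodf eta) = prodf (upd eta i g').
  apply/funext => x; rewrite /pderiv.
  exact: (@derive_val _ _ _ _ _ _ _ (is_derive_prodf dg' x)).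
have test : test_fun Omega (prodf eta).
  by apply: (test_fun_prodf (a := a) (b := b)) => //; exact: subset_trans abpq pqO.
have cphi : continuous (prodf eta).
  by apply: continuous_prodf => k; exact: smooth1_continuous.
have cpsi : continuous (prodf (upd eta i g')).
  by apply: continuous_prodf => k; rewrite /upd; case: ifP => _; exact: smooth1_continuous.
have cut_mul (u psi : T -> R) : (forall x, ~ box a b x -> psi x = 0%R) ->
    (fun x => (u x * psi x)%:E) = (fun x => (cut u x * psi x)%:E).
  move=> psi0; apply/funext => x; have [xQ|xQ] := pselect (box p q x); first by rewrite cutE.
  by rewrite psi0 ?mulr0 // => /abpq.
have icut (u psi : T -> R) : loc_int Omega u -> continuous psi ->
    (forall x, ~ box a b x -> psi x = 0%R) ->
    (mu m).-integrable setT (fun x => (cut u x * psi x)%:E).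
  move=> lu cp p0; apply: (integrableMl measurableT (integrable_cut lu)).
    exact: continuous_measurable_rV.
  exact: bounded_continuous_supported p0.
have := weak _ test; rewrite pdE (cut_mul f _ psi_out) (cut_mul g _ phi_out).
by rewrite (iint_mu (icut _ _ lf cpsi psi_out)) (iint_mu (icut _ _ lg cphi phi_out)).
Unshelve. all: by end_near. Qed.

End cutoff.

(** * Gluing local almost-everywhere statements *)

Section almost_everywhere.
Context {R : realType} (m : nat) (Omega : set 'rV[R]_m).

Lemma ae_on_ae (P : 'rV[R]_m -> Prop) : ae_on Omega P ->
  {ae mu m, forall x, Omega x -> P x}.
Proof.
move=> [N [/lnull_negligible[A [mA A0 NA]] NP]]; exists A; split => // x /= /not_implyP[Ox nP].
by apply: NA; apply: contrapT => Nx; exact: nP (NP _ Ox Nx).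
Qed.

Lemma ae_ae_on (P : 'rV[R]_m -> Prop) : (0 < m)%N ->
  {ae mu m, forall x, Omega x -> P x} -> ae_on Omega P.
Proof.
move=> m0 HP; exists (~` [set x | Omega x -> P x]); split.
  exact: negligible_lnull.
by move=> x Ox /contrapT; exact.
Qed.

Lemma ae_countable (I : countType) (P : I -> 'rV[R]_m -> Prop) :
  (forall i, {ae mu m, forall x, P i x}) -> {ae mu m, forall x, forall i, P i x}.
Proof.
move=> HP; pose Q k x := if unpickle k is Some i then P i x else True.
have HQ : {ae mu m, forall x, forall k, Q k x}.
  apply: ae_foralln => k; rewrite /Q; case: (unpickle k) => [i|]; first exact: HP.
  exact: aeW.
by apply: ae_imp HQ => x Qx i; have := Qx (pickle i); rewrite /Q pickleK.
Qed.

(** Every point of [Omega] lies in a box with rational corners that stays in [Omega] when its upper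
    corner is moved out by some [1/(N+1)]; there are countably many such boxes and margins. *)
Lemma ae_open_box (P : 'rV[R]_m -> Prop) : open Omega ->
  (forall p q (eta : R), 0 < eta -> box p q `<=` Omega ->
    {ae mu m, forall x, box p (q - const_mx eta) x -> P x}) ->
  {ae mu m, forall x, Omega x -> P x}.
Proof.
move=> oO HP.
pose pb (t : 'rV[rat]_m * 'rV[rat]_m * nat) : 'rV[R]_m := map_mx ratr t.1.1.
pose qb (t : 'rV[rat]_m * 'rV[rat]_m * nat) : 'rV[R]_m := map_mx ratr t.1.2.
pose eta (t : 'rV[rat]_m * 'rV[rat]_m * nat) : R := t.2.+1%:R^-1.
have : {ae mu m, forall x, forall t, box (pb t) (qb t + const_mx (eta t)) `<=` Omega ->
    box (pb t) (qb t) x -> P x}.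
  apply: ae_countable => t.
  have [tO|tO] := pselect (box (pb t) (qb t + const_mx (eta t)) `<=` Omega); last first.
    by apply: aeW => x /tO.
  have e0 : 0 < eta t by rewrite invr_gt0.
  by apply: ae_imp (HP _ _ _ e0 tO) => x; rewrite addrK => H _; exact: H.
apply: ae_imp => x Hx Ox.
have /nbhs_ballP[e /= e0 xeO] := open_nbhs_nbhs (conj oO Ox).
have e20 : 0 < e / 2 by rewrite divr_gt0.
have H1 (i : 'I_m) : exists r : rat, x ord0 i - e / 2 < ratr r < x ord0 i.
  have [|r] := @rat_in_itvoo R (x ord0 i - e / 2) (x ord0 i); first by lra.
  by rewrite in_itv /=; exists r.
have H2 (i : 'I_m) : exists r : rat, x ord0 i < ratr r < x ord0 i + e / 2.
  have [|r] := @rat_in_itvoo R (x ord0 i) (x ord0 i + e / 2); first by lra.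
  by rewrite in_itv /=; exists r.
have [q1 q1P] := choice H1; have [q2 q2P] := choice H2.
have [N _ HN] := near_infty_natSinv_lt (PosNum e20).
have Ne : N.+1%:R^-1 < e / 2 := HN N (leqnn N).
apply: (Hx (\row_i q1 i, \row_i q2 i, N)) => [y yb|i]; last first.
  by rewrite !mxE; have := q1P i; have := q2P i; lra.
apply: xeO; split => // i j; rewrite !ord1.
have := yb j; rewrite !mxE /ball /= ltr_norml; have := q1P j; have := q2P j.
move: Ne; rewrite /eta /=; move: (N.+1%:R^-1) => w; lra.
Qed.

End almost_everywhere.

Theorem theorem6p2 (R : realType) (n m : nat)
  (Omega : set 'rV[R]_m)
  (f : 'rV[R]_m -> 'rV[R]_(2 * n).+1)
  (Df : 'rV[R]_m -> 'M[R]_((2 * n).+1, m)) :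
  (0 < n)%N -> (n + 1 <= m)%N -> (m <= 2 * n)%N ->
  open Omega ->
  weak_jacobian Omega f Df ->
  ae_on Omega (fun x => forall i : 'I_m,
    Df x (inord (2 * n)) i =
    \sum_(j < n) (f x ord0 (inord j) * Df x (inord (j + n)) i
                  - f x ord0 (inord (j + n)) * Df x (inord j) i)) ->
  ae_on Omega (fun x => (\rank (Df x) <= n)%N).
Proof.
move=> n0 nm m2n oO [f0 [Df0 [/ae_on_ae ff0 /ae_on_ae DD0 lf lDf weak]]] /ae_on_ae contact.
apply: ae_ae_on; first by lia.
(* The equation is moved to the Borel representatives, whose measurability the line integrals
   require. *)
have contact0 : {ae mu m, forall x, Omega x -> forall i,
    Df0 x (inord (2 * n)) i = \sum_(k < n) (f0 x ord0 (inord k) * Df0 x (inord (k + n)) i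
      - f0 x ord0 (inord (k + n)) * Df0 x (inord k) i)}.
  apply: ae_imp2 contact (ae_imp2 (fun _ => @conj _ _) ff0 DD0) => x c [fx Dx] Ox i.
  by rewrite -(fx Ox) -(Dx Ox); exact: c.
have iso : {ae mu m, forall x, Omega x -> forall ij : 'I_m * 'I_m,
    \sum_(k < n) (Df0 x (inord k) ij.1 * Df0 x (inord (k + n)) ij.2
      - Df0 x (inord (k + n)) ij.1 * Df0 x (inord k) ij.2) = 0}.
  apply: ae_open_box => // p q eta eta0 pqO.
  pose c j := cut p q (fun x => f0 x ord0 j).
  pose dc j i := cut p q (fun x => Df0 x j i).
  have ic j : (mu m).-integrable setT (EFin \o c j) by exact: integrable_cut (lf j).
  have idc j i : (mu m).-integrable setT (EFin \o dc j i) by exact: integrable_cut (lDf j i).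
  have wc j i : weakd p q (c j) (dc j i) i.
    by apply: (weakd_cut pqO (lf j) (lDf j i)) => phi tphi; exact: weak.
  have cc : {ae mu m, forall x, box p q x -> forall i, dc (inord (2 * n)) i x =
      \sum_(k < n) (c (inord k) x * dc (inord (k + n)) i x - c (inord (k + n)) x * dc (inord k) i x)}.
    apply: ae_imp contact0 => x c0 xQ i; rewrite /dc cutE // (c0 (pqO _ xQ)).
    by apply: eq_bigr => k _; rewrite /c !cutE.
  suff : {ae mu m, forall x, forall ij : 'I_m * 'I_m, box p (q - const_mx eta) x ->
      \sum_(k < n) (dc (inord k) ij.1 x * dc (inord (k + n)) ij.2 x
        - dc (inord (k + n)) ij.1 x * dc (inord k) ij.2 x) = 0}.
    apply: ae_imp => x Hx xQ ij; apply: etrans (Hx ij xQ); apply: eq_bigr => k _.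
    rewrite /dc !cutE // => l; have := xQ l; rewrite !mxE; lra.
  apply: ae_forall => -[i j].
  exact: (isotropic_ae (fun k => ic (inord k)) (fun k => ic (inord (k + n))) (ic _)
    (fun k => idc (inord k)) (fun k => idc (inord (k + n))) (idc _)
    (fun k => wc (inord k)) (fun k => wc (inord (k + n))) (wc _) cc i j eta0).
apply: ae_imp2 DD0 (ae_imp2 (fun _ => @conj _ _) contact0 iso) => x Dx [cx ix] Ox.
rewrite (Dx Ox); apply: rank_contact (cx Ox) => i j.
exact: (ix Ox (i, j)).
Qed.
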